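(* Let $f : \mathbb{N} \to \mathbb{Z}$ be a function such that for some $t \in \mathbb{N}$ we have $|f(n)| \leq n^t$ for all $n \geq n(t)$. Define, for integers $n$, $$A_f(n) := \#\{(x,y) \in \mathbb{N}\times\mathbb{N} : f(x) + f(y) = n\}, \qquad \tilde A_f(n) := \#\{(x,y) \in \mathbb{N}\times\mathbb{N} : f(x) - f(y) = n\}.$$ Assume that either $A_f(n) = O(|n|^{\varepsilon})$ as $|n| \to \infty$ for every $\varepsilon > 0$, or $\tilde A_f(n) = O(|n|^{\varepsilon})$ as $n \to \infty$ for every $\varepsilon>0$. Then for almost all $\alpha \in \mathbb{R}$ the discrepancy $D_N$ of $(\{f(n)\alpha\})_{n\geq 1}$ satisfies: for every $\varepsilon > 0$ there are infinitely many $N$ with $$N D_N \geq N^{\frac12 - \varepsilon}.$$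
   Context: For real $x$, $\{x\}$ denotes the fractional part of $x$. For a sequence $(x_n)_{n\ge1}$ in $[0,1)$, its discrepancy is $$D_N = \sup_{0 \leq a < b \leq 1} \left| \frac{A_N([a,b))}{N} - (b-a) \right|, \qquad A_N([a,b)) = \#\{1 \leq n \leq N : x_n \in [a,b)\}.$$ *)

(* Defs.v *)
From Stdlib Require Import Reals Lra Lia ZArith List.
Open Scope R_scope.

(* Natural numbers are N = {1,2,3,...} (the sequence is indexed by n >= 1). *)

Definition A_trunc (f : nat -> Z) (K : nat) (n : Z) : nat :=
  length (filter (fun p => Z.eqb (f (fst p) + f (snd p))%Z n)
                 (list_prod (seq 1 K) (seq 1 K))).

Definition Atilde_trunc (f : nat -> Z) (K : nat) (n : Z) : nat :=
  length (filter (fun p => Z.eqb (f (fst p) - f (snd p))%Z n)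
                 (list_prod (seq 1 K) (seq 1 K))).

(* "A_f(n) <= B" (with A_f(n) possibly infinite) iff every truncation is <= B *)
Definition A_le (f : nat -> Z) (n : Z) (B : R) : Prop :=
  forall K, INR (A_trunc f K n) <= B.
Definition Atilde_le (f : nat -> Z) (n : Z) (B : R) : Prop :=
  forall K, INR (Atilde_trunc f K n) <= B.

Definition A_small (f : nat -> Z) : Prop :=
  forall eps, 0 < eps -> exists C M, (1 <= M)%Z /\
    forall n : Z, (M <= Z.abs n)%Z -> A_le f n (C * Rpower (IZR (Z.abs n)) eps).

Definition Atilde_small (f : nat -> Z) : Prop :=
  forall eps, 0 < eps -> exists C M, (1 <= M)%Z /\
    forall n : Z, (M <= n)%Z -> Atilde_le f n (C * Rpower (IZR n) eps).

Definition xseq (f : nat -> Z) (alpha : R) (n : nat) : R :=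
  frac_part (IZR (f n) * alpha).

Definition count_in (x : nat -> R) (N : nat) (a b : R) : nat :=
  length (filter (fun n => if Rle_dec a (x n) then
                             (if Rlt_dec (x n) b then true else false)
                           else false) (seq 1 N)).

Definition is_discrepancy (x : nat -> R) (N : nat) (d : R) : Prop :=
  is_lub (fun r => exists a b, 0 <= a /\ a < b /\ b <= 1 /\
                    r = Rabs (INR (count_in x N a b) / INR N - (b - a))) d.

Definition null_set (E : R -> Prop) : Prop :=
  forall eps, 0 < eps -> exists a b : nat -> R,
    (forall k, a k <= b k) /\
    (forall x, E x -> exists k, a k < x < b k) /\
    (forall m, sum_f_R0 (fun k => b k - a k) m <= eps).

(* Main.v *)
Require Import Defs.
From Stdlib Require Import Reals ZArith Lra Lia List Classical ClassicalEpsilon.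
Open Scope R_scope.

(** Write [S_N(x) = sum_(n <= N) e(f(n) x)]. Koksma's inequality bounds [|S_N(h alpha)|] by a
    constant times [h N D_N], so it suffices to find, for almost every [alpha], infinitely many
    [N] and an [h] of size [N^o(1)] with [|S_N(h alpha)|^2 >= N / 2]. Average
    [|S_N(h alpha)|^2] over the [D] integers [h] following [D^(2r)], with [N = D^q]. The mean in
    [alpha] is [mu = #{f x = f y} >= N]. A nonzero integer below [D^(r^2)] has at most [r]
    divisors among these [h], because the product of [r] such divisors [k_i] divides it up to
    the factor [prod_(i<j) (k_i - k_j)]; hence the variance is at most [r / D] times the number
    of solutions of [f x - f y = f z - f w]. The hypothesis on [A_f] or [Atilde_f] bounds
    that number by [N^(2 + o(1))] if [f] is unbounded, and it is trivially [O(mu^2)] if [f] is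
    bounded. So by Chebyshev's inequality the average is below [mu / 2] only on a set of measure
    tending to [0]. All integrals are replaced by sums over a grid fine enough for exact
    orthogonality, so that the exceptional set is covered by explicit finite lists of
    intervals. *)

(** * Finite sums over lists *)

Definition Rsum {A : Type} (F : A -> R) (l : list A) : R :=
  fold_right (fun a s => F a + s) 0 l.

Lemma Rsum_cons {A} (F : A -> R) a l : Rsum F (a :: l) = F a + Rsum F l.
Proof. reflexivity. Qed.

Lemma Rsum_app {A} (F : A -> R) l1 l2 : Rsum F (l1 ++ l2) = Rsum F l1 + Rsum F l2.
Proof. induction l1 as [|a l IH]; simpl; [lra|]. rewrite IH; lra. Qed.

Lemma Rsum_ext_in {A} (F G : A -> R) l :
  (forall a, In a l -> F a = G a) -> Rsum F l = Rsum G l.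
Proof.
  induction l as [|a l IH]; simpl; intros H; [reflexivity|].
  rewrite (H a), IH; auto.
Qed.

Lemma Rsum_ext {A} (F G : A -> R) l : (forall a, F a = G a) -> Rsum F l = Rsum G l.
Proof. intros H; apply Rsum_ext_in; auto. Qed.

Lemma Rsum_le_in {A} (F G : A -> R) l :
  (forall a, In a l -> F a <= G a) -> Rsum F l <= Rsum G l.
Proof.
  induction l as [|a l IH]; simpl; intros H; [lra|].
  apply Rplus_le_compat; auto.
Qed.

Lemma Rsum_plus {A} (F G : A -> R) l :
  Rsum (fun a => F a + G a) l = Rsum F l + Rsum G l.
Proof. induction l as [|a l IH]; simpl; [lra|]. rewrite IH; lra. Qed.

Lemma Rsum_scal {A} c (F : A -> R) l : Rsum (fun a => c * F a) l = c * Rsum F l.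
Proof. induction l as [|a l IH]; simpl; [lra|]. rewrite IH; lra. Qed.

Lemma Rsum_const {A} c (l : list A) : Rsum (fun _ => c) l = INR (length l) * c.
Proof.
  induction l as [|a l IH]; [simpl; lra|].
  rewrite Rsum_cons, IH. cbn [length]. rewrite S_INR. lra.
Qed.

Lemma Rsum_zero {A} (F : A -> R) l : (forall a, In a l -> F a = 0) -> Rsum F l = 0.
Proof.
  intros H. rewrite (Rsum_ext_in F (fun _ => 0)) by auto. rewrite Rsum_const; lra.
Qed.

Lemma Rsum_le_const {A} c (F : A -> R) l :
  (forall a, In a l -> F a <= c) -> Rsum F l <= INR (length l) * c.
Proof. intros H. rewrite <- Rsum_const. apply Rsum_le_in; auto. Qed.

Lemma Rsum_nonneg {A} (F : A -> R) l : (forall a, In a l -> 0 <= F a) -> 0 <= Rsum F l.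
Proof.
  intros H. replace 0 with (Rsum (fun _ : A => 0) l) by (rewrite Rsum_const; lra).
  apply Rsum_le_in; auto.
Qed.

Lemma Rabs_Rsum {A} (F : A -> R) l : Rabs (Rsum F l) <= Rsum (fun a => Rabs (F a)) l.
Proof.
  induction l as [|a l IH]; simpl; [rewrite Rabs_R0; lra|].
  eapply Rle_trans; [apply Rabs_triang|lra].
Qed.

Lemma Rsum_exchange {A B} (F : A -> B -> R) l m :
  Rsum (fun a => Rsum (F a) m) l = Rsum (fun b => Rsum (fun a => F a b) l) m.
Proof.
  induction l as [|a l IH]; simpl.
  - symmetry; apply Rsum_zero; auto.
  - rewrite IH, <- Rsum_plus. reflexivity.
Qed.

Lemma Rsum_map {A B} (F : B -> R) (u : A -> B) l :
  Rsum F (map u l) = Rsum (fun a => F (u a)) l.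
Proof. induction l as [|a l IH]; simpl; [reflexivity|]. rewrite IH; reflexivity. Qed.

Lemma Rsum_flat_map {A B} (F : B -> R) (u : A -> list B) l :
  Rsum F (flat_map u l) = Rsum (fun a => Rsum F (u a)) l.
Proof. induction l as [|a l IH]; simpl; [reflexivity|]. rewrite Rsum_app, IH; reflexivity. Qed.

Lemma Rsum_list_prod {A B} (F : A * B -> R) l m :
  Rsum F (list_prod l m) = Rsum (fun a => Rsum (fun b => F (a, b)) m) l.
Proof.
  induction l as [|a l IH]; simpl; [reflexivity|].
  rewrite Rsum_app, IH, Rsum_map; reflexivity.
Qed.

Lemma Rsum_mul {A B} (F : A -> R) (G : B -> R) l m :
  Rsum F l * Rsum G m = Rsum (fun a => Rsum (fun b => F a * G b) m) l.
Proof.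
  rewrite Rmult_comm, <- Rsum_scal. apply Rsum_ext; intros a.
  rewrite Rsum_scal. lra.
Qed.

Lemma Rsum_filter {A} (F : A -> R) (b : A -> bool) l :
  Rsum F (filter b l) = Rsum (fun a => if b a then F a else 0) l.
Proof.
  induction l as [|a l IH]; simpl; [reflexivity|].
  destruct (b a); simpl; rewrite IH; lra.
Qed.

Lemma length_filter_Rsum {A} (b : A -> bool) l :
  INR (length (filter b l)) = Rsum (fun a => if b a then 1 else 0) l.
Proof.
  rewrite <- Rsum_filter, Rsum_const. lra.
Qed.

Lemma Rsum_ge_term {A} (F : A -> R) l a :
  (forall b, In b l -> 0 <= F b) -> In a l -> F a <= Rsum F l.
Proof.
  induction l as [|b l IH]; simpl; intros H; [tauto|].
  intros [->|Ha].
  - assert (0 <= Rsum F l) by (apply Rsum_nonneg; auto). lra.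
  - assert (F a <= Rsum F l) by (apply IH; auto).
    assert (0 <= F b) by auto. lra.
Qed.

(** Cauchy-Schwarz, by expanding the nonnegative double sum of [(F a - F b) ^ 2]. *)
Lemma Rsum_sqr_le {A} (F : A -> R) l :
  Rsum F l ^ 2 <= INR (length l) * Rsum (fun a => F a ^ 2) l.
Proof.
  assert (H : 0 <= Rsum (fun a => Rsum (fun b => (F a - F b) ^ 2) l) l).
  { do 2 (apply Rsum_nonneg; intros). apply pow2_ge_0. }
  rewrite (Rsum_ext _ (fun a => INR (length l) * F a ^ 2 + (Rsum (fun b => F b ^ 2) l
     + - 2 * (F a * Rsum F l)))) in H.
  - rewrite !Rsum_plus, Rsum_const, !Rsum_scal in H.
    rewrite (Rsum_ext (fun a => F a * Rsum F l) (fun a => Rsum F l * F a)) in H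
      by (intros; ring).
    rewrite Rsum_scal in H. nra.
  - intros a.
    rewrite (Rsum_ext _ (fun b => F a ^ 2 + (F b ^ 2 + - 2 * (F a * F b))))
      by (intros; ring).
    rewrite !Rsum_plus, Rsum_const, !Rsum_scal. ring.
Qed.

(** Cauchy-Schwarz at the cost of the size of the support instead of the length of [l]; through it a
    bound on the number of divisors becomes a bound on the energy. *)
Lemma Rsum_sqr_le_support {A} (F : A -> R) (b : A -> bool) l :
  (forall a, In a l -> b a = false -> F a = 0) ->
  Rsum F l ^ 2 <= INR (length (filter b l)) * Rsum (fun a => F a ^ 2) l.
Proof.
  intros H.
  rewrite (Rsum_ext_in F (fun a => if b a then F a else 0)).
  2:{ intros a Ha. destruct (b a) eqn:E; auto. }
  rewrite <- Rsum_filter. eapply Rle_trans; [apply Rsum_sqr_le|].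
  apply Rmult_le_compat_l; [apply pos_INR|].
  rewrite Rsum_filter. apply Rsum_le_in. intros a _.
  destruct (b a); [lra|]. apply pow2_ge_0.
Qed.

(** * Additive energy of a list of integers *)

Definition Zdelta (a b : Z) : R := if Z.eqb a b then 1 else 0.

Lemma Zdelta_range a b : 0 <= Zdelta a b <= 1.
Proof. unfold Zdelta; destruct (Z.eqb a b); lra. Qed.

Lemma Zdelta_congr a b c d : (a = b <-> c = d) -> Zdelta a b = Zdelta c d.
Proof.
  unfold Zdelta; intros H.
  destruct (Z.eqb_spec a b), (Z.eqb_spec c d); tauto.
Qed.

Lemma Zdelta_neq a b : a <> b -> Zdelta a b = 0.
Proof. unfold Zdelta; destruct (Z.eqb_spec a b); tauto. Qed.

Lemma Zdelta_refl a : Zdelta a a = 1.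
Proof. unfold Zdelta. rewrite Z.eqb_refl. reflexivity. Qed.

(** Entries count with repetition. On [vals f N] this is the mean $\mu$ of $|S_N|^2$; on [diffs v]
    it is the additive energy of [v], the number of solutions of $a - b = c - d$. *)
Definition energy (l : list Z) : R := Rsum (fun a => Rsum (fun b => Zdelta a b) l) l.

Definition multiplicity (l : list Z) (n : Z) : R := Rsum (fun a => Zdelta a n) l.

Lemma Rsum_Zdelta_out V a (F : Z -> R) : ~ In a V -> Rsum (fun n => Zdelta a n * F n) V = 0.
Proof.
  intros H. apply Rsum_zero. intros n Hn. rewrite Zdelta_neq; [lra|]. intros ->; auto.
Qed.

Lemma Rsum_Zdelta_in V a (F : Z -> R) : NoDup V -> In a V -> Rsum (fun n => Zdelta a n * F n) V = F a.
Proof.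
  induction 1 as [|n V Hn HV IH]; simpl; [tauto|].
  intros [->|Ha].
  - rewrite Zdelta_refl, Rsum_Zdelta_out by auto. lra.
  - rewrite IH by auto. rewrite Zdelta_neq; [lra|]. intros ->; auto.
Qed.

Lemma Rsum_multiplicity_sqr V l :
  Rsum (fun n => multiplicity l n ^ 2) V =
  Rsum (fun a => Rsum (fun b => Rsum (fun n => Zdelta a n * Zdelta b n) V) l) l.
Proof.
  rewrite (Rsum_ext _ (fun n => Rsum (fun a => Rsum (fun b => Zdelta a n * Zdelta b n) l) l)).
  2:{ intros n. unfold multiplicity. rewrite <- Rsum_mul. ring. }
  rewrite Rsum_exchange. apply Rsum_ext; intros a. apply Rsum_exchange.
Qed.

Lemma Rsum_multiplicity_sqr_le_energy V l :
  NoDup V -> Rsum (fun n => multiplicity l n ^ 2) V <= energy l.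
Proof.
  intros HV. rewrite Rsum_multiplicity_sqr. unfold energy.
  do 2 (apply Rsum_le_in; intros).
  destruct (in_dec Z.eq_dec a V) as [i|i].
  - rewrite Rsum_Zdelta_in by auto. apply Req_le, Zdelta_congr; intuition congruence.
  - rewrite Rsum_Zdelta_out by auto. apply Zdelta_range.
Qed.

Lemma Rsum_multiplicity_sqr_eq_energy V l :
  NoDup V -> incl l V -> Rsum (fun n => multiplicity l n ^ 2) V = energy l.
Proof.
  intros HV Hl. rewrite Rsum_multiplicity_sqr. unfold energy.
  do 2 (apply Rsum_ext_in; intros).
  rewrite Rsum_Zdelta_in by auto. apply Zdelta_congr; intuition congruence.
Qed.

Lemma Rsum_multiplicity V l : NoDup V -> incl l V -> Rsum (multiplicity l) V = INR (length l).
Proof.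
  intros HV Hl. unfold multiplicity. rewrite Rsum_exchange.
  rewrite (Rsum_ext_in _ (fun _ => 1)); [rewrite Rsum_const; lra|].
  intros a Ha. rewrite (Rsum_ext _ (fun n => Zdelta a n * 1)) by (intros; lra).
  apply (Rsum_Zdelta_in V a (fun _ => 1)); auto.
Qed.

Lemma energy_ge_length l : INR (length l) <= energy l.
Proof.
  replace (INR (length l)) with (Rsum (fun _ : Z => 1) l) by (rewrite Rsum_const; lra).
  apply Rsum_le_in. intros a Ha. rewrite <- (Zdelta_refl a).
  apply (Rsum_ge_term (fun b => Zdelta a b)); auto. intros; apply Zdelta_range.
Qed.

Definition dilates (H l : list Z) : list Z := flat_map (fun h => map (Z.mul h) l) H.

Lemma energy_map_mul h l : h <> 0%Z -> energy (map (Z.mul h) l) = energy l.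
Proof.
  intros Hh. unfold energy. rewrite Rsum_map. apply Rsum_ext; intros a.
  rewrite Rsum_map. apply Rsum_ext; intros b. apply Zdelta_congr. nia.
Qed.

(** The multiplicity of $n$ in [dilates H l] is the sum over $h$ of its multiplicities in $h l$, and
    only the divisors $h$ of $n$, at most [r] of them, contribute. Cauchy-Schwarz costs a factor
    [r], and each dilate has the energy of [l]. *)
Lemma energy_dilates (H l : list Z) (r : nat) :
  (forall h, In h H -> h <> 0%Z) ->
  (forall n, In n (dilates H l) ->
     (length (filter (fun h => Z.eqb (n mod h) 0) H) <= r)%nat) ->
  energy (dilates H l) <= INR r * INR (length H) * energy l.
Proof.
  intros H0 Hr. set (T := dilates H l) in *.
  set (V := nodup Z.eq_dec T).
  assert (HV : NoDup V) by apply NoDup_nodup.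
  assert (HTV : forall n, In n V <-> In n T) by (intros; apply nodup_In).
  rewrite <- (Rsum_multiplicity_sqr_eq_energy V) by (auto; intros n; apply HTV).
  apply Rle_trans with
    (Rsum (fun n => INR r * Rsum (fun h => multiplicity (map (Z.mul h) l) n ^ 2) H) V).
  - apply Rsum_le_in. intros n Hn.
    unfold multiplicity at 1, T, dilates. rewrite Rsum_flat_map.
    eapply Rle_trans.
    + apply (Rsum_sqr_le_support _ (fun h => Z.eqb (n mod h) 0)).
      intros h Hh E. apply Rsum_zero. intros a Ha. apply Zdelta_neq. intros ->.
      apply in_map_iff in Ha. destruct Ha as (d & <- & _).
      rewrite Z.mul_comm, Z_mod_mult in E. discriminate.
    + apply Rmult_le_compat_r.
      * apply Rsum_nonneg; intros; apply pow2_ge_0.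
      * apply le_INR, Hr, HTV; auto.
  - rewrite Rsum_scal, Rsum_exchange, Rmult_assoc.
    apply Rmult_le_compat_l; [apply pos_INR|].
    apply Rsum_le_const. intros h Hh. rewrite <- (energy_map_mul h) by auto.
    apply Rsum_multiplicity_sqr_le_energy; auto.
Qed.

(** * Few divisors in a short interval *)

Definition Zprod (l : list Z) : Z := fold_right Z.mul 1%Z l.

(* With [V = prod (k - k_i)] one has [V = P * (-1)^s + k * z], where [P = prod k_i];
   so [P | m] and [k | m] give [P * k | m * V], without any gcd. *)
Lemma Zprod_sub_mod (k : Z) l :
  exists e z, Zprod (map (fun a => k - a)%Z l) = (e * Zprod l + k * z)%Z.
Proof.
  induction l as [|a l (e & z & IH)]; simpl.
  - exists 1%Z, 0%Z; lia.
  - exists (- e)%Z, (e * Zprod l + k * z - a * z)%Z. rewrite IH. ring.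
Qed.

Lemma Zprod_sub_bound (D k : Z) l :
  (1 <= D)%Z -> (forall a, In a l -> a <> k /\ (Z.abs (k - a) <= D)%Z) ->
  Zprod (map (fun a => k - a)%Z l) <> 0%Z /\
  (Z.abs (Zprod (map (fun a => k - a)%Z l)) <= D ^ Z.of_nat (length l))%Z.
Proof.
  intros HD. induction l as [|a l IH]; intros H.
  - simpl. lia.
  - cbn [map Zprod fold_right length].
    destruct IH as [I1 I2]; [intros; apply H; simpl; auto|].
    destruct (H a) as [H1 H2]; [simpl; auto|].
    fold (Zprod (map (fun a => k - a)%Z l)). split; [nia|].
    rewrite Nat2Z.inj_succ, Z.pow_succ_r, Z.abs_mul by lia.
    apply Z.mul_le_mono_nonneg; lia.
Qed.

(** [E] is the product of the pairwise differences. Each new entry [k] contributes [V], a product of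
    at most [r] differences and so at most [D ^ r] in absolute value. *)
Lemma Zprod_dvd (D n : Z) (r : nat) (l : list Z) :
  (1 <= D)%Z -> NoDup l -> (length l <= r)%nat ->
  (forall a b, In a l -> In b l -> (Z.abs (a - b) <= D)%Z) ->
  (forall a, In a l -> (a | n)%Z) ->
  exists E, E <> 0%Z /\ (Z.abs E <= D ^ (Z.of_nat r * Z.of_nat (length l)))%Z /\
            (Zprod l | n * E)%Z.
Proof.
  intros HD. induction l as [|k l IH]; intros Hnd Hlen Hdiff Hdvd.
  - exists 1%Z. split; [lia|]. split; [simpl; rewrite Z.mul_0_r; simpl; lia|].
    simpl; apply Z.divide_1_l.
  - inversion_clear Hnd as [|? ? Hk Hl]. cbn [length] in *.
    destruct IH as (E & HE0 & HE & [u Hu]);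
      [assumption | lia | intros; apply Hdiff; simpl; auto | intros; apply Hdvd; simpl; auto |].
    destruct (Zprod_sub_bound D k l) as [HV0 HV]; auto.
    { intros a Ha. split; [intros ->; auto|]. apply Hdiff; simpl; auto. }
    destruct (Zprod_sub_mod k l) as (e & z & Hez).
    destruct (Hdvd k) as [w Hw]; [simpl; auto|].
    set (V := Zprod (map (fun a => k - a)%Z l)) in *.
    exists (E * V)%Z. split; [nia|]. split.
    + replace (Z.of_nat r * Z.of_nat (S (length l)))%Z
        with (Z.of_nat r * Z.of_nat (length l) + Z.of_nat r)%Z by lia.
      rewrite Z.pow_add_r, Z.abs_mul by lia.
      apply Z.mul_le_mono_nonneg; try lia.
      eapply Z.le_trans; [apply HV|]. apply Z.pow_le_mono_r; lia.
    (* With $P$ = [Zprod l], $n = wk$ and $nE = uP$, the identity $V = eP + kz$ gives $nEV = wkEeP +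
       uPkz = (wEe + uz)kP$. *)
    + exists (w * E * e + u * z)%Z. cbn [Zprod fold_right]. fold (Zprod l).
      rewrite Z.mul_assoc, Hez.
      replace (n * E * (e * Zprod l + k * z))%Z
        with ((n * E) * e * Zprod l + (n * E) * (k * z))%Z by ring.
      rewrite Hu at 2. rewrite Hw. ring.
Qed.

Lemma Zprod_ge (B : Z) l :
  (0 <= B)%Z -> (forall a, In a l -> (B <= a)%Z) -> (B ^ Z.of_nat (length l) <= Zprod l)%Z.
Proof.
  intros HB. induction l as [|a l IH]; intros H.
  - simpl; lia.
  - cbn [length Zprod fold_right]. fold (Zprod l).
    rewrite Nat2Z.inj_succ, Z.pow_succ_r by lia.
    assert (0 <= B ^ Z.of_nat (length l))%Z by (apply Z.pow_nonneg; lia).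
    apply Z.mul_le_mono_nonneg; try lia; [apply H; simpl; auto|].
    apply IH; intros; apply H; simpl; auto.
Qed.

Lemma firstn_In {A} n (l : list A) a : In a (firstn n l) -> In a l.
Proof. intros H. rewrite <- (firstn_skipn n l). apply in_or_app; auto. Qed.

(** Put $X = D^{r^2}$. If more than [r] entries divided [n], the product of [r] of them would be at
    least $X^2$ and would divide $nE$, where $0 < |n| < X$ and $0 < |E| \le X$. *)
Lemma few_divisors (D n : Z) (r : nat) (l : list Z) :
  (1 <= D)%Z -> NoDup l ->
  (forall a, In a l -> (D ^ (2 * Z.of_nat r) < a <= D ^ (2 * Z.of_nat r) + D)%Z) ->
  n <> 0%Z -> (Z.abs n < D ^ (Z.of_nat r * Z.of_nat r))%Z ->
  (length (filter (fun h => Z.eqb (n mod h) 0) l) <= r)%nat.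
Proof.
  intros HD Hnd Hl Hn0 Hn. apply Nat.nlt_ge. intros Hlt.
  set (m := filter (fun h => Z.eqb (n mod h) 0) l) in *.
  assert (Hm : forall a, In a (firstn r m) -> In a l /\ (a | n)%Z).
  { intros a Ha. apply firstn_In, filter_In in Ha. destruct Ha as [Ha E].
    split; auto. apply Z.eqb_eq in E. apply Z.mod_divide; auto.
    specialize (Hl a Ha). assert (0 < D ^ (2 * Z.of_nat r))%Z by (apply Z.pow_pos_nonneg; lia).
    lia. }
  assert (Hlen : length (firstn r m) = r) by (rewrite length_firstn; lia).
  destruct (Zprod_dvd D n r (firstn r m)) as (E & HE0 & HE & Hdvd); auto.
  - apply (NoDup_app_remove_r _ (skipn r m)). rewrite firstn_skipn.
    apply NoDup_filter; auto.
  - lia.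
  - intros a b Ha Hb. apply Hm in Ha, Hb. destruct Ha as [Ha _], Hb as [Hb _].
    apply Hl in Ha, Hb. lia.
  - apply Hm.
  - assert (H1 := Zprod_ge (D ^ (2 * Z.of_nat r)) (firstn r m)).
    rewrite Hlen in *.
    assert ((D ^ (2 * Z.of_nat r)) ^ Z.of_nat r <= Zprod (firstn r m))%Z.
    { apply H1.
      - apply Z.pow_nonneg; lia.
      - intros a Ha. apply Hm in Ha. destruct Ha as [Ha _]. apply Hl in Ha. lia. }
    apply Z.divide_abs_r in Hdvd. apply Z.divide_pos_le in Hdvd; [|nia].
    rewrite Z.abs_mul in Hdvd.
    set (X := (D ^ (Z.of_nat r * Z.of_nat r))%Z) in *.
    assert (HX : ((D ^ (2 * Z.of_nat r)) ^ Z.of_nat r = X * X)%Z).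
    { unfold X. rewrite <- Z.pow_mul_r, <- Z.pow_add_r by lia. f_equal. lia. }
    rewrite HX in *. nia.
Qed.

(** * Cosine sums and their orthogonality on a grid *)

Lemma sin_period_Z x (k : Z) : sin (x + 2 * PI * IZR k) = sin x.
Proof.
  assert (H : forall y n, sin (y + 2 * PI * INR n) = sin y).
  { intros y n. rewrite <- (sin_period y n). f_equal. ring. }
  destruct (Z_le_gt_dec 0 k) as [Hk|Hk].
  - rewrite <- (Z2Nat.id k), <- INR_IZR_INZ by lia. apply H.
  - rewrite <- (H (x + 2 * PI * IZR k) (Z.to_nat (- k))), INR_IZR_INZ, Z2Nat.id by lia.
    f_equal. rewrite opp_IZR. ring.
Qed.

Lemma cos_period_Z x (k : Z) : cos (x + 2 * PI * IZR k) = cos x.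
Proof.
  rewrite !cos_sin. rewrite <- (sin_period_Z (PI / 2 + x) k). f_equal. ring.
Qed.

Lemma Rabs_sin_le x : Rabs (sin x) <= Rabs x.
Proof.
  assert (H : forall y, 0 < y -> Rabs (sin y) <= y).
  { intros y Hy. apply Rabs_le. assert (H1 := sin_lt_x y Hy).
    split; [|lra]. destruct (Rle_lt_dec y PI) as [Hp|Hp].
    - assert (0 <= sin y) by (apply sin_ge_0; lra). lra.
    - assert (H2 := SIN_bound y). assert (H3 := PI2_3_2). lra. }
  destruct (Rtotal_order x 0) as [Hx|[->|Hx]].
  - rewrite (Rabs_left x) by lra. rewrite <- (Rabs_Ropp (sin x)), <- sin_neg. apply H; lra.
  - rewrite sin_0; lra.
  - rewrite (Rabs_right x) by lra. apply H; lra.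
Qed.

Lemma cos_lipschitz a b : Rabs (cos a - cos b) <= Rabs (a - b).
Proof.
  rewrite form2, !Rabs_mult, (Rabs_left (-2)) by lra.
  assert (H1 := Rabs_sin_le ((a - b) / 2)).
  assert (H2 : Rabs (sin ((a + b) / 2)) <= 1) by (apply Rabs_le; apply SIN_bound).
  assert (H3 := Rabs_pos (sin ((a - b) / 2))). assert (H4 := Rabs_pos (sin ((a + b) / 2))).
  unfold Rdiv in H1 at 2. rewrite Rabs_mult, (Rabs_right (/ 2)) in H1 by lra.
  nra.
Qed.

(** With $u = 2bj + \theta$, each $2 \sin b \cos u$ equals $\sin(u + b) - \sin(u - b)$, and $u + b$
    is the next value of $u - b$. *)
Lemma Rsum_cos_telescope b th n :
  2 * sin b * Rsum (fun j => cos (2 * b * INR j + th)) (seq 0 n) =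
  sin (2 * b * INR n + th - b) - sin (th - b).
Proof.
  induction n as [|n IH].
  - simpl. rewrite Rmult_0_r, Rmult_0_r, Rplus_0_l. lra.
  - rewrite seq_S, Rsum_app, Rmult_plus_distr_l, IH. cbn [Rsum fold_right Nat.add].
    rewrite S_INR. set (u := 2 * b * INR n + th).
    replace (2 * b * (INR n + 1) + th - b) with (u + b) by (unfold u; ring).
    rewrite sin_plus, sin_minus. ring.
Qed.

(** For $b = \pi m / Q$ the telescoped sum closes up after whole periods, and $\sin b \ne 0$ because
    $0 < |m| < Q$. The phase [th] serves both to shift the grid and to pass from cosines to
    sines. *)
Lemma Rsum_cos_grid (m : Z) (Q n : nat) th :
  m <> 0%Z -> (Z.abs m < Z.of_nat Q)%Z ->
  Rsum (fun j => cos (2 * PI * IZR m * (INR j / INR Q) + th)) (seq 0 (n * Q)) = 0.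
Proof.
  intros Hm HQ.
  assert (HQp : 0 < INR Q) by (apply lt_0_INR; lia).
  set (b := PI * (IZR m / INR Q)).
  assert (Hb : sin b <> 0).
  { assert (H : forall k : Z, (0 < k < Z.of_nat Q)%Z -> 0 < sin (PI * (IZR k / INR Q))).
    { intros k [H1 H2]. apply IZR_lt in H1, H2. rewrite <- INR_IZR_INZ in H2.
      assert (Hpi := PI_RGT_0).
      assert (0 < IZR k / INR Q) by (apply Rdiv_lt_0_compat; lra).
      assert (IZR k / INR Q < 1).
      { apply Rmult_lt_reg_r with (INR Q); auto. unfold Rdiv.
        rewrite Rmult_assoc, Rinv_l; lra. }
      apply sin_gt_0; nra. }
    destruct (Z_lt_le_dec 0 m).
    - assert (0 < sin b) by (apply H; lia). lra.
    - specialize (H (- m)%Z ltac:(lia)). rewrite opp_IZR in H.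
      replace (PI * (- IZR m / INR Q)) with (- b) in H by (unfold b; field; lra).
      rewrite sin_neg in H. lra. }
  assert (H := Rsum_cos_telescope b th (n * Q)).
  replace (2 * b * INR (n * Q) + th - b) with (th - b + 2 * PI * IZR (m * Z.of_nat n)) in H.
  2:{ unfold b. rewrite mult_INR, mult_IZR, <- INR_IZR_INZ. field. lra. }
  rewrite sin_period_Z, Rminus_diag in H.
  rewrite (Rsum_ext _ (fun j => cos (2 * b * INR j + th))).
  2:{ intros j. f_equal. unfold b. field. lra. }
  nra.
Qed.

Lemma Rsum_cos_sin_sqr {A} (u : A -> R) l :
  Rsum (fun a => cos (u a)) l ^ 2 + Rsum (fun a => sin (u a)) l ^ 2 =
  Rsum (fun a => Rsum (fun b => cos (u a - u b)) l) l.
Proof.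
  simpl. rewrite !Rmult_1_r, !Rsum_mul, <- Rsum_plus.
  apply Rsum_ext; intros a. rewrite <- Rsum_plus.
  apply Rsum_ext; intros b. rewrite cos_minus. reflexivity.
Qed.

(** The real part of the exponential sum. For a list symmetric under negation, such as a list of all
    differences, the sine part vanishes and nothing is lost. *)
Definition cosum (l : list Z) (x : R) : R := Rsum (fun a => cos (2 * PI * IZR a * x)) l.

(** Adding the square of the sine sum gives the double sum of $\cos(2\pi(a - b)x)$. Over the grid
    the pairs with $a \ne b$ cancel exactly, and each pair of equal entries contributes at most the
    number of grid points. *)
Lemma cosum_grid_mean_square (l : list Z) (Q n : nat) (K : Z) :
  (forall a b, In a l -> In b l -> (Z.abs (a - b) < Z.of_nat Q)%Z) ->
  Rsum (fun j => cosum l (INR j / INR Q - IZR K) ^ 2) (seq 0 (n * Q))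
    <= INR (n * Q) * energy l.
Proof.
  intros HQ.
  apply Rle_trans with
   (Rsum (fun j => Rsum (fun a => Rsum (fun b =>
      cos (2 * PI * IZR (a - b) * (INR j / INR Q) + 2 * PI * IZR (- ((a - b) * K)))) l) l)
      (seq 0 (n * Q))).
  - apply Rsum_le_in. intros j _. unfold cosum.
    set (x := INR j / INR Q - IZR K).
    assert (H := Rsum_cos_sin_sqr (fun a => 2 * PI * IZR a * x) l).
    apply Rle_trans with
      (Rsum (fun a => Rsum (fun b => cos (2 * PI * IZR a * x - 2 * PI * IZR b * x)) l) l).
    + rewrite <- H. assert (H2 := pow2_ge_0 (Rsum (fun a => sin (2 * PI * IZR a * x)) l)). lra.
    + apply Req_le. do 2 (apply Rsum_ext; intros). f_equal. unfold x.
      rewrite opp_IZR, mult_IZR, minus_IZR. ring.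
  - rewrite Rsum_exchange. unfold energy. rewrite <- Rsum_scal.
    apply Rsum_le_in; intros a Ha. rewrite Rsum_exchange, <- Rsum_scal.
    apply Rsum_le_in; intros b Hb. destruct (Z.eq_dec a b) as [->|Hab].
    + rewrite Zdelta_refl. replace (INR (n * Q)) with (INR (length (seq 0 (n * Q))))
        by (rewrite length_seq; reflexivity).
      apply Rsum_le_const. intros; apply COS_bound.
    + rewrite Rsum_cos_grid by (auto; lia). rewrite Zdelta_neq by auto. lra.
Qed.

Lemma cosum_lipschitz (l : list Z) (W : R) x y :
  (forall a, In a l -> IZR (Z.abs a) <= W) ->
  Rabs (cosum l x - cosum l y) <= INR (length l) * (2 * PI * W * Rabs (x - y)).
Proof.
  intros HW. unfold cosum.
  replace (Rsum (fun a => cos (2 * PI * IZR a * x)) l - Rsum (fun a => cos (2 * PI * IZR a * y)) l)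
    with (Rsum (fun a => cos (2 * PI * IZR a * x) - cos (2 * PI * IZR a * y)) l).
  2:{ unfold Rminus. rewrite Rsum_plus.
      rewrite (Rsum_ext (fun a => - cos (2 * PI * IZR a * y)) (fun a => -1 * cos (2 * PI * IZR a * y)))
        by (intros; ring). rewrite Rsum_scal. ring. }
  eapply Rle_trans; [apply Rabs_Rsum|]. apply Rsum_le_const. intros a Ha.
  eapply Rle_trans; [apply cos_lipschitz|].
  replace (2 * PI * IZR a * x - 2 * PI * IZR a * y) with (2 * PI * (IZR a * (x - y))) by ring.
  rewrite Rabs_mult, (Rabs_right (2 * PI)), Rabs_mult by (assert (H := PI_RGT_0); lra).
  rewrite Rabs_Zabs. specialize (HW a Ha). assert (Hp := PI_RGT_0).
  rewrite (Rmult_assoc (2 * PI)). apply Rmult_le_compat_l; [lra|].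
  apply Rmult_le_compat_r; [apply Rabs_pos|auto].
Qed.

Lemma cosum_dilates (H l : list Z) x :
  cosum (dilates H l) x = Rsum (fun h => cosum l (IZR h * x)) H.
Proof.
  unfold cosum, dilates. rewrite Rsum_flat_map. apply Rsum_ext; intros h.
  rewrite Rsum_map. apply Rsum_ext; intros a. f_equal. rewrite mult_IZR. ring.
Qed.

(** * Discrepancy bounds exponential sums *)

Definition lt_ind (x u : R) : R := if Rlt_dec x u then 1 else 0.

Lemma count_in_Rsum x N b :
  (forall n, 0 <= x n) ->
  INR (count_in x N 0 b) = Rsum (fun n => lt_ind (x n) b) (seq 1 N).
Proof.
  intros Hx. unfold count_in. rewrite length_filter_Rsum. apply Rsum_ext; intros n.
  unfold lt_ind. destruct (Rle_dec 0 (x n)) as [_|H]; [|destruct H; auto].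
  destruct (Rlt_dec (x n) b); reflexivity.
Qed.

(** A discrete form of $\phi(x) = \phi(1) - \int_x^1 \phi'$. The increments kept by the indicator
    start at the cell containing [x], so [F] telescopes to $\phi(n/P)$ minus the value of $\phi$ at
    the left end of that cell, which is within $L/P$ of $\phi(x)$. *)
Lemma step_approx (phi : R -> R) (L x : R) (P n : nat) :
  (0 < P)%nat -> 0 <= x -> (forall u v, Rabs (phi u - phi v) <= L * Rabs (u - v)) -> 0 <= L ->
  let F := Rsum (fun k => (phi (INR (S k) / INR P) - phi (INR k / INR P))
                          * lt_ind x (INR (S k) / INR P)) (seq 0 n) in
  (INR n / INR P <= x -> F = 0) /\
  (x < INR n / INR P -> Rabs (phi (INR n / INR P) - F - phi x) <= L / INR P).
Proof.
  intros HP Hx HL HL0. apply lt_0_INR in HP. induction n as [|n [IH1 IH2]]; intros F.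
  - split; [reflexivity|]. simpl (INR 0). unfold Rdiv. rewrite Rmult_0_l. lra.
  - set (F0 := Rsum _ (seq 0 n)) in IH1, IH2.
    assert (HF : F = F0 + (phi (INR (S n) / INR P) - phi (INR n / INR P))
                          * lt_ind x (INR (S n) / INR P)).
    { unfold F. rewrite seq_S, Rsum_app. cbn [Rsum fold_right Nat.add]. fold F0. ring. }
    assert (Hstep : INR (S n) / INR P = INR n / INR P + / INR P) by (rewrite S_INR; field; lra).
    assert (Hinv : 0 < / INR P) by (apply Rinv_0_lt_compat; auto).
    unfold lt_ind in HF. destruct (Rlt_dec x (INR (S n) / INR P)) as [H|H].
    + split; [lra|]. intros _. destruct (Rlt_le_dec x (INR n / INR P)) as [H1|H1].
      * replace (phi (INR (S n) / INR P) - F - phi x) with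
          (phi (INR n / INR P) - F0 - phi x) by (rewrite HF; ring). auto.
      * replace (phi (INR (S n) / INR P) - F - phi x) with
          (phi (INR n / INR P) - phi x) by (rewrite HF, IH1 by auto; ring).
        eapply Rle_trans; [apply HL|]. apply Rmult_le_compat_l; auto. apply Rabs_le. lra.
    + split; [|lra]. intros H1. rewrite HF, IH1; lra.
Qed.

Lemma Rsum_by_parts (a : nat -> R) (n : nat) :
  Rsum (fun k => (a (S k) - a k) * INR (S k)) (seq 0 n) = INR n * a n - Rsum a (seq 0 n).
Proof.
  induction n as [|n IH]; [simpl; ring|].
  rewrite seq_S, !Rsum_app, IH. cbn [Rsum fold_right Nat.add]. rewrite S_INR. ring.
Qed.

(** After the step approximation, the counts for $[0, (k+1)/P)$ are weighted by the increments of
    $\phi$. The expected counts cancel, leaving [P] increments of size at most $L/P$ times counting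
    errors [e k] of size at most $Nd$. The last term of the bound is the error of the
    approximation. *)
Lemma koksma_cos_grid (x : nat -> R) (N : nat) (d : R) (h : Z) th (P : nat) :
  (1 <= N)%nat -> (forall n, 0 <= x n < 1) -> is_discrepancy x N d ->
  (0 < h < Z.of_nat P)%Z ->
  Rabs (Rsum (fun n => cos (2 * PI * IZR h * x n + th)) (seq 1 N))
    <= 2 * PI * IZR h * (INR N * d) + INR N * (2 * PI * IZR h) / INR P.
Proof.
  intros HN Hx Hd Hh.
  assert (HP : 0 < INR P) by (apply lt_0_INR; lia).
  assert (HN' : 0 < INR N) by (apply lt_0_INR; lia).
  assert (Hh' : 0 < IZR h) by (apply IZR_lt; lia).
  assert (Hpi := PI_RGT_0).
  set (L := 2 * PI * IZR h). assert (HL : 0 < L) by (unfold L; nra).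
  set (phi := fun u => cos (L * u + th)).
  assert (Hphi : forall u v, Rabs (phi u - phi v) <= L * Rabs (u - v)).
  { intros u v. eapply Rle_trans; [apply cos_lipschitz|].
    replace (L * u + th - (L * v + th)) with (L * (u - v)) by ring.
    rewrite Rabs_mult, (Rabs_right L) by lra. lra. }
  set (dphi := fun k => phi (INR (S k) / INR P) - phi (INR k / INR P)).
  set (Fx := fun n => Rsum (fun k => dphi k * lt_ind (x n) (INR (S k) / INR P)) (seq 0 P)).
  assert (HPP : INR P / INR P = 1) by (field; lra).
  set (e := fun k => INR (count_in x N 0 (INR (S k) / INR P)) - INR N * (INR (S k) / INR P)).
  assert (He : forall k, In k (seq 0 P) -> Rabs (e k) <= INR N * d).
  { intros k Hk. apply in_seq in Hk.
    assert (H1 : INR (S k) / INR P <= 1).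
    { rewrite <- HPP. apply Rmult_le_compat_r; [left; apply Rinv_0_lt_compat; auto|].
      apply le_INR; lia. }
    assert (H2 : 0 < INR (S k) / INR P).
    { apply Rdiv_lt_0_compat; auto. apply lt_0_INR; lia. }
    destruct Hd as [Hub _].
    specialize (Hub (Rabs (INR (count_in x N 0 (INR (S k) / INR P)) / INR N
                           - (INR (S k) / INR P - 0)))).
    assert (H3 : Rabs (INR (count_in x N 0 (INR (S k) / INR P)) / INR N
                           - (INR (S k) / INR P - 0)) <= d).
    { apply Hub. exists 0, (INR (S k) / INR P). repeat split; try lra. }
    replace (e k) with (INR N * (INR (count_in x N 0 (INR (S k) / INR P)) / INR N
                           - (INR (S k) / INR P - 0))) by (unfold e; field; lra).
    rewrite Rabs_mult, (Rabs_right (INR N)) by lra. apply Rmult_le_compat_l; lra. }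
  (* Summation by parts turns the expected counts into $N\phi(1)$ minus a multiple of the sum of
     $\phi$ over the grid, and that sum vanishes because $0 < h < P$. *)
  assert (Hmain : Rsum (fun n => phi 1 - Fx n) (seq 1 N) = - Rsum (fun k => dphi k * e k) (seq 0 P)).
  { unfold Rminus at 1. rewrite Rsum_plus, Rsum_const, length_seq.
    rewrite (Rsum_ext (fun n => - Fx n) (fun n => -1 * Fx n)) by (intros; ring).
    rewrite Rsum_scal. unfold Fx. rewrite Rsum_exchange.
    rewrite (Rsum_ext _ (fun k => dphi k * INR (count_in x N 0 (INR (S k) / INR P)))).
    2:{ intros k. rewrite Rsum_scal, count_in_Rsum by apply Hx. reflexivity. }
    rewrite (Rsum_ext (fun k => dphi k * e k)
      (fun k => dphi k * INR (count_in x N 0 (INR (S k) / INR P)) +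
                (- (INR N / INR P)) * (dphi k * INR (S k)))).
    2:{ intros k. unfold e. field. lra. }
    rewrite Rsum_plus, Rsum_scal.
    unfold dphi at 3.
    rewrite (Rsum_by_parts (fun k => phi (INR k / INR P))).
    assert (H0 := Rsum_cos_grid h P 1 th ltac:(lia) ltac:(lia)).
    rewrite Nat.mul_1_l in H0. change (fun k => phi (INR k / INR P)) with
      (fun j => cos (2 * PI * IZR h * (INR j / INR P) + th)).
    rewrite H0, HPP. field. lra. }
  replace (Rsum (fun n => cos (L * x n + th)) (seq 1 N)) with
    (Rsum (fun n => - (phi 1 - Fx n - phi (x n))) (seq 1 N)
     + Rsum (fun n => phi 1 - Fx n) (seq 1 N)).
  2:{ rewrite <- Rsum_plus. apply Rsum_ext; intros n. unfold phi. ring. }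
  eapply Rle_trans; [apply Rabs_triang|]. rewrite Rplus_comm. apply Rplus_le_compat.
  - rewrite Hmain, Rabs_Ropp. eapply Rle_trans; [apply Rabs_Rsum|].
    replace (L * (INR N * d)) with (INR (length (seq 0 P)) * (L / INR P * (INR N * d)))
      by (rewrite length_seq; field; lra).
    apply Rsum_le_const. intros k Hk. rewrite Rabs_mult.
    apply Rmult_le_compat; auto using Rabs_pos.
    unfold dphi. eapply Rle_trans; [apply Hphi|]. apply Rmult_le_compat_l; [lra|].
    replace (INR (S k) / INR P - INR k / INR P) with (/ INR P) by (rewrite S_INR; field; lra).
    rewrite Rabs_right; [lra|]. left; apply Rinv_0_lt_compat; auto.
  - eapply Rle_trans; [apply Rabs_Rsum|].
    replace (INR N * L / INR P) with (INR (length (seq 1 N)) * (L / INR P))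
      by (rewrite length_seq; field; lra).
    apply Rsum_le_const. intros n _. rewrite Rabs_Ropp.
    destruct (step_approx phi L (x n) P P ltac:(lia) ltac:(apply Hx) Hphi ltac:(lra)) as [_ H].
    rewrite HPP in H. apply H, Hx.
Qed.

Lemma koksma_cos (x : nat -> R) (N : nat) (d : R) (h : Z) th :
  (1 <= N)%nat -> (forall n, 0 <= x n < 1) -> is_discrepancy x N d -> (0 < h)%Z ->
  Rabs (Rsum (fun n => cos (2 * PI * IZR h * x n + th)) (seq 1 N))
    <= 2 * PI * IZR h * (INR N * d).
Proof.
  intros HN Hx Hd Hh. apply Rle_plus_epsilon. intros eps Heps.
  set (Y := INR N * (2 * PI * IZR h)).
  assert (HY : 0 <= Y).
  { assert (H := PI_RGT_0). assert (H1 := pos_INR N). apply IZR_lt in Hh. unfold Y.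
    apply Rmult_le_pos; [lra|]. nra. }
  (* [P] exceeds [h], as orthogonality needs, and makes the approximation error $Y/P$ at most
     [eps]. *)
  destruct (INR_unbounded (Y / eps + IZR h)) as [P HP].
  assert (H0 : 0 <= Y / eps) by (apply Rmult_le_pos; [|left; apply Rinv_0_lt_compat]; lra).
  assert (Hh' := IZR_lt _ _ Hh).
  assert (HhP : (h < Z.of_nat P)%Z) by (apply lt_IZR; rewrite <- INR_IZR_INZ; lra).
  eapply Rle_trans; [apply (koksma_cos_grid x N d h th P); auto; lia|].
  apply Rplus_le_compat_l. fold Y.
  apply Rmult_le_reg_r with (INR P); [lra|].
  unfold Rdiv. rewrite Rmult_assoc, Rinv_l by lra.
  assert (Y = Y / eps * eps) by (field; lra). nra.
Qed.

(** * Null sets from finite covers *)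

(** Finite covers express zero content, which is stronger than measure zero and confines [E] to a
    bounded range. *)
Definition has_small_covers (E : R -> Prop) : Prop :=
  forall eta, 0 < eta -> exists l : list (R * R),
    (forall p, In p l -> fst p <= snd p) /\
    (forall x, E x -> exists p, In p l /\ fst p < x < snd p) /\
    Rsum (fun p => snd p - fst p) l <= eta.

Lemma sum_f_R0_Rsum u m : sum_f_R0 u m = Rsum u (seq 0 (S m)).
Proof.
  induction m as [|m IH]; [simpl; ring|].
  rewrite seq_S, Rsum_app, <- IH. simpl. ring.
Qed.

(** The default [d] has weight zero, so indices past the end of [l] add nothing. *)
Lemma Rsum_nth_le {A} (g : A -> R) (d : A) l n :
  g d = 0 -> (forall a, In a l -> 0 <= g a) ->
  Rsum (fun k => g (nth k l d)) (seq 0 n) <= Rsum g l.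
Proof.
  intros Hd. revert n. induction l as [|a l IH]; intros n Hg.
  - rewrite Rsum_zero; [simpl; lra|]. intros k _. destruct k; auto.
  - destruct n as [|n]; [apply Rsum_nonneg; auto|].
    cbn [seq]. rewrite <- seq_shift, !Rsum_cons, Rsum_map. apply Rplus_le_compat_l.
    apply IH. intros; apply Hg; simpl; auto.
Qed.

(** The set [En n] gets a cover of total length at most $\varepsilon / 2^{n+1}$, and all these
    covers are concatenated into one sequence of intervals. *)
Lemma null_set_of_small_covers (E : R -> Prop) (En : nat -> R -> Prop) :
  (forall n, has_small_covers (En n)) -> (forall x, E x -> exists n, En n x) -> null_set E.
Proof.
  intros Hsc Hsub eps Heps.
  assert (Hex : forall n, exists l : list (R * R),
    (forall p, In p l -> fst p <= snd p) /\
    (forall x, En n x -> exists p, In p l /\ fst p < x < snd p) /\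
    Rsum (fun p => snd p - fst p) l <= eps * (1 / 2) ^ S n).
  { intros n. apply Hsc. apply Rmult_lt_0_compat; auto. apply pow_lt. lra. }
  set (c := fun n => proj1_sig (constructive_indefinite_description _ (Hex n))).
  assert (Hc := fun n => proj2_sig (constructive_indefinite_description _ (Hex n))).
  change (forall n,
    (forall p, In p (c n) -> fst p <= snd p) /\
    (forall x, En n x -> exists p, In p (c n) /\ fst p < x < snd p) /\
    Rsum (fun p => snd p - fst p) (c n) <= eps * (1 / 2) ^ S n) in Hc.
  (* Padding with an empty interval makes the n-th prefix have length at least n. *)
  set (C := fun n => flat_map (fun k => (0, 0) :: c k) (seq 0 n)).
  assert (CS : forall n, C (S n) = C n ++ (0, 0) :: c n).
  { intros n. unfold C. rewrite seq_S, flat_map_app. simpl. rewrite app_nil_r. reflexivity. }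
  assert (Clen : forall n, (n <= length (C n))%nat).
  { induction n as [|n IH]; [lia|]. rewrite CS, length_app. simpl. lia. }
  assert (Cnth : forall n m k, (k < n)%nat -> (n <= m)%nat ->
     nth k (C m) (0, 0) = nth k (C n) (0, 0)).
  { intros n m k Hk Hm. induction Hm as [|m Hm IH]; [reflexivity|].
    rewrite CS, app_nth1; auto. specialize (Clen m). lia. }
  assert (Cle : forall n p, In p (C n) -> fst p <= snd p).
  { intros n p Hp. unfold C in Hp. apply in_flat_map in Hp.
    destruct Hp as (k & _ & [<-|Hp]); [simpl; lra|]. apply (Hc k); auto. }
  assert (Csum : forall n, Rsum (fun p => snd p - fst p) (C n) <= eps * (1 - (1 / 2) ^ n)).
  { induction n as [|n IH]; [simpl; lra|].
    rewrite CS, Rsum_app, Rsum_cons. destruct (Hc n) as (_ & _ & Hn). cbn [fst snd].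
    simpl in Hn |- *. lra. }
  (* The prefix [C (S k)] has more than [k] entries, so its entry at [k] is not a default value and
     agrees with that of every longer prefix. *)
  set (F := fun k => nth k (C (S k)) (0, 0)).
  assert (HF : forall m k, (k < m)%nat -> F k = nth k (C m) (0, 0)).
  { intros m k Hk. symmetry. apply Cnth; lia. }
  exists (fun k => fst (F k)), (fun k => snd (F k)). split; [|split].
  - intros k. unfold F. apply (Cle (S k)). apply nth_In. specialize (Clen (S k)). lia.
  - intros x Hx. destruct (Hsub x Hx) as [n Hn].
    destruct (Hc n) as (_ & Hcov & _). destruct (Hcov x Hn) as (p & Hp & Hxp).
    assert (Hin : In p (C (S n))) by (rewrite CS; apply in_or_app; simpl; auto).
    destruct (In_nth _ _ (0, 0) Hin) as (k & Hk & Hnth).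
    exists k. replace (F k) with p; auto.
    rewrite (HF (Nat.max (S k) (S n))) by lia. rewrite <- Hnth.
    symmetry.
    destruct (Nat.le_ge_cases (S k) (S n)).
    + apply Cnth; lia.
    (* Position [k] may lie beyond [n], so [Cnth] does not apply to [C (S n)]. Later prefixes only
       append to it, which leaves the entry in place. *)
    + assert (Happ : forall m, exists t, C (S n + m)%nat = C (S n) ++ t).
      { induction m as [|m [t Ht]]; [exists nil; rewrite Nat.add_0_r, app_nil_r; auto|].
        rewrite Nat.add_succ_r, CS, Ht, <- app_assoc. eexists; reflexivity. }
      destruct (Happ (Nat.max (S k) (S n) - S n)%nat) as [t Ht].
      replace (S n + (Nat.max (S k) (S n) - S n))%nat with (Nat.max (S k) (S n)) in Ht by lia.
      rewrite Ht, app_nth1; auto.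
  - intros m. rewrite sum_f_R0_Rsum.
    rewrite (Rsum_ext_in _ (fun k => snd (nth k (C (S m)) (0, 0)) - fst (nth k (C (S m)) (0, 0)))).
    2:{ intros k Hk. apply in_seq in Hk. rewrite (HF (S m)) by lia. reflexivity. }
    eapply Rle_trans.
    + apply (Rsum_nth_le (fun p => snd p - fst p) (0, 0)); [simpl; lra|].
      intros p Hp. apply Cle in Hp. lra.
    + eapply Rle_trans; [apply Csum|].
      assert (0 < (1 / 2) ^ S m) by (apply pow_lt; lra). nra.
Qed.

(** * Energy of the difference set *)

Definition diffs (v : list Z) : list Z := map (fun p => fst p - snd p)%Z (list_prod v v).
Definition nzdiffs (v : list Z) : list Z := filter (fun a => negb (Z.eqb a 0)) (diffs v).

Lemma Rsum_diffs (F : Z -> R) v :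
  Rsum F (diffs v) = Rsum (fun a => Rsum (fun b => F (a - b)%Z) v) v.
Proof. unfold diffs. rewrite Rsum_map, Rsum_list_prod. reflexivity. Qed.

(** The right side is $|\sum_a e(ax)|^2$ over the entries $a$ of [v]. *)
Lemma cosum_diffs v x :
  cosum (diffs v) x = Rsum (fun a => cos (2 * PI * IZR a * x)) v ^ 2
                    + Rsum (fun a => sin (2 * PI * IZR a * x)) v ^ 2.
Proof.
  rewrite (Rsum_cos_sin_sqr (fun a => 2 * PI * IZR a * x)).
  unfold cosum. rewrite Rsum_diffs. do 2 (apply Rsum_ext; intros).
  f_equal. rewrite minus_IZR. ring.
Qed.

(** The zero differences give the mean of $|S|^2$; the others give the oscillating part, to which
    Chebyshev's inequality is applied. *)
Lemma cosum_diffs_split v x : cosum (diffs v) x = energy v + cosum (nzdiffs v) x.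
Proof.
  unfold nzdiffs, cosum. rewrite Rsum_filter. rewrite !Rsum_diffs.
  unfold energy. rewrite <- Rsum_plus. apply Rsum_ext; intros a.
  rewrite <- Rsum_plus. apply Rsum_ext; intros b.
  unfold Zdelta. destruct (Z.eqb_spec a b) as [->|Hab].
  - rewrite Z.sub_diag. simpl. rewrite Rmult_0_r, Rmult_0_l, cos_0. ring.
  - destruct (Z.eqb_spec (a - b) 0); [lia|]. simpl. ring.
Qed.

Lemma energy_filter_le b l : energy (filter b l) <= energy l.
Proof.
  unfold energy. rewrite Rsum_filter. apply Rsum_le_in; intros x _.
  rewrite Rsum_filter. destruct (b x).
  - apply Rsum_le_in; intros y _. destruct (b y); [lra|apply Zdelta_range].
  - apply Rsum_nonneg; intros; apply Zdelta_range.
Qed.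

Lemma energy_le_length_sqr l : energy l <= INR (length l) ^ 2.
Proof.
  unfold energy. simpl. rewrite Rmult_1_r.
  apply Rsum_le_const. intros a _. rewrite <- (Rmult_1_r (INR (length l))).
  apply Rsum_le_const. intros; apply Zdelta_range.
Qed.

(** The sign [s] lets one argument serve both hypotheses: $s = 1$ corresponds to $A_f$ and $s = -1$
    to $\tilde A_f$. *)
Definition repr (s : Z) (v : list Z) (n : Z) : R :=
  Rsum (fun a => Rsum (fun b => Zdelta (a + s * b) n) v) v.

(** The equation $a - b = c - d$ is kept for $s = -1$ and rearranged as $a + d = c + b$ for $s =
    1$. *)
Lemma energy_diffs_repr s v :
  s = 1%Z \/ s = (-1)%Z ->
  energy (diffs v) = Rsum (fun a => Rsum (fun b => repr s v (a + s * b)%Z) v) v.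
Proof.
  intros Hs. unfold energy, repr. rewrite Rsum_diffs.
  rewrite (Rsum_ext _ (fun a => Rsum (fun b => Rsum (fun c => Rsum (fun d =>
     Zdelta (a - b) (c - d)) v) v) v)).
  2:{ intros a. apply Rsum_ext; intros b. apply Rsum_diffs. }
  apply Rsum_ext; intros a. destruct Hs as [-> | ->].
  - transitivity (Rsum (fun c => Rsum (fun d => Rsum (fun b => Zdelta (a - b) (c - d)) v) v) v).
    + rewrite Rsum_exchange. apply Rsum_ext; intros c. apply Rsum_exchange.
    + rewrite (Rsum_exchange (fun c d => Rsum (fun b => Zdelta (a - b) (c - d)) v)).
      do 3 (apply Rsum_ext; intros). apply Zdelta_congr. lia.
  - do 3 (apply Rsum_ext; intros). apply Zdelta_congr. lia.
Qed.

Definition Zrange (c : Z) (n : nat) : list Z := map (fun i => c + Z.of_nat i)%Z (seq 0 n).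

Lemma in_Zrange c n a : In a (Zrange c n) <-> (c <= a < c + Z.of_nat n)%Z.
Proof.
  unfold Zrange. rewrite in_map_iff. split.
  - intros (i & <- & Hi). apply in_seq in Hi. lia.
  - intros H. exists (Z.to_nat (a - c)). split; [lia|]. apply in_seq. lia.
Qed.

Lemma NoDup_Zrange c n : NoDup (Zrange c n).
Proof. apply NoDup_map_NoDup_ForallPairs; [|apply seq_NoDup]. intros i j _ _ H. lia. Qed.

Lemma length_Zrange c n : length (Zrange c n) = n.
Proof. unfold Zrange. rewrite length_map, length_seq. reflexivity. Qed.

Section EnergyOfDifferences.
Variables (s : Z) (v : list Z) (M : nat) (X : R).
Hypothesis Hs : s = 1%Z \/ s = (-1)%Z.
Hypothesis HX : 0 <= X.
Hypothesis Hrepr : forall a b, In a v -> In b v ->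
  (Z.of_nat M <= Z.abs (a + s * b))%Z -> repr s v (a + s * b) <= X.
Hypothesis Hfar : exists w1 w2, In w1 v /\ In w2 v /\ (2 * Z.of_nat M <= Z.abs (w1 - w2))%Z.

Let len := INR (length v).

(** One of the two values supplied by [Hfar] serves as $w$ with $|c + sw| \ge M$. Each occurrence of
    $c$ in [v] then gives a representation of $c + sw$. *)
Lemma multiplicity_le_of_repr c : multiplicity v c <= X.
Proof.
  destruct (in_dec Z.eq_dec c v) as [Hc|Hc].
  2:{ unfold multiplicity. rewrite Rsum_zero; auto. intros a Ha. apply Zdelta_neq. intros ->; auto. }
  assert (Hw : exists w, In w v /\ (Z.of_nat M <= Z.abs (c + s * w))%Z).
  { destruct Hfar as (w1 & w2 & H1 & H2 & H3).
    destruct (Z_le_gt_dec (Z.of_nat M) (Z.abs (c + s * w1))); [exists w1; auto|].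
    exists w2. split; auto. destruct Hs; subst s; lia. }
  destruct Hw as (w & Hw & Hwl). eapply Rle_trans; [|apply (Hrepr c w); auto].
  apply Rsum_le_in; intros a _.
  replace (Zdelta a c) with (Zdelta (a + s * w) (c + s * w)) by (apply Zdelta_congr; lia).
  apply (Rsum_ge_term (fun b => Zdelta (a + s * b) (c + s * w))); auto.
  intros; apply Zdelta_range.
Qed.

(** Weaker than [Hrepr] by the factor [len], but valid also for $n$ near zero: once $b$ is fixed,
    $a$ must equal $n - sb$. *)
Lemma repr_le n : repr s v n <= len * X.
Proof.
  unfold repr. rewrite Rsum_exchange. apply Rsum_le_const. intros b _.
  eapply Rle_trans; [|apply (multiplicity_le_of_repr (n - s * b))].
  apply Rsum_le_in; intros a _. apply Req_le, Zdelta_congr. lia.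
Qed.

(** Pairs with $|a + sb| \ge M$ contribute at most $X$ each. The remaining sums lie among the $2M$
    integers of [V], each reached by at most [len * X] pairs, and each such pair contributes at most
    [len * X]. *)
Lemma energy_diffs_le : energy (diffs v) <= len ^ 2 * (X + 2 * INR M * X ^ 2).
Proof.
  rewrite (energy_diffs_repr s) by auto.
  set (V := Zrange (- Z.of_nat M) (2 * M)).
  apply Rle_trans with
    (Rsum (fun a => Rsum (fun b => X + len * X * Rsum (Zdelta (a + s * b)) V) v) v).
  - apply Rsum_le_in; intros a Ha; apply Rsum_le_in; intros b Hb.
    assert (Hl : 0 <= len) by apply pos_INR.
    assert (H0 : 0 <= Rsum (Zdelta (a + s * b)) V)
      by (apply Rsum_nonneg; intros; apply Zdelta_range).
    destruct (Z_le_gt_dec (Z.of_nat M) (Z.abs (a + s * b))).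
    + assert (repr s v (a + s * b) <= X) by auto.
      assert (0 <= len * X * Rsum (Zdelta (a + s * b)) V)
        by (repeat apply Rmult_le_pos; auto). lra.
    + assert (1 <= Rsum (Zdelta (a + s * b)) V).
      { rewrite <- (Zdelta_refl (a + s * b)) at 1. apply (Rsum_ge_term (Zdelta (a + s * b))).
        - intros; apply Zdelta_range.
        - apply in_Zrange. lia. }
      assert (Hr := repr_le (a + s * b)).
      assert (0 <= len * X) by (apply Rmult_le_pos; auto). nra.
  - rewrite (Rsum_ext _ (fun a => len * X + len * X * Rsum (fun b => Rsum (Zdelta (a + s * b)) V) v)).
    2:{ intros a. rewrite Rsum_plus, Rsum_const, Rsum_scal. reflexivity. }
    rewrite Rsum_plus, Rsum_const, Rsum_scal. fold len.
    assert (H : Rsum (fun a => Rsum (fun b => Rsum (Zdelta (a + s * b)) V) v) v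
                <= INR (length V) * (len * X)).
    { rewrite (Rsum_ext _ (fun a => Rsum (fun n => Rsum (fun b => Zdelta (a + s * b) n) v) V))
        by (intros; apply Rsum_exchange).
      rewrite Rsum_exchange. apply Rsum_le_const. intros n _. apply repr_le. }
    unfold V in H at 2. rewrite length_Zrange, mult_INR in H. simpl (INR 2) in H.
    assert (0 <= len * X) by (apply Rmult_le_pos; auto; apply pos_INR).
    nra.
Qed.

End EnergyOfDifferences.

Lemma length_diffs v : length (diffs v) = (length v * length v)%nat.
Proof. unfold diffs. rewrite length_map, length_prod. reflexivity. Qed.

(** The trivial bound is the fourth power of the length, and Cauchy-Schwarz over the [n] possible
    values bounds the squared length by [INR n * energy v]. *)
Lemma energy_diffs_le_clustered v c n :
  (forall a, In a v -> (c <= a < c + Z.of_nat n)%Z) ->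
  energy (diffs v) <= INR n ^ 2 * energy v ^ 2.
Proof.
  intros Hv. eapply Rle_trans; [apply energy_le_length_sqr|].
  rewrite length_diffs, mult_INR.
  assert (H : INR (length v) ^ 2 <= INR n * energy v).
  { rewrite <- (Rsum_multiplicity (Zrange c n) v).
    - eapply Rle_trans; [apply Rsum_sqr_le|]. rewrite length_Zrange.
      apply Rmult_le_compat_l; [apply pos_INR|]. apply Rsum_multiplicity_sqr_le_energy, NoDup_Zrange.
    - apply NoDup_Zrange.
    - intros a Ha. apply in_Zrange; auto. }
  assert (H0 := pow2_ge_0 (INR (length v))). rewrite <- Rpow_mult_distr.
  apply pow_incr. simpl in *. lra.
Qed.

(** * Energy bounds from the hypotheses on [f] *)

Definition vals (f : nat -> Z) (N : nat) : list Z := map f (seq 1 N).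

Lemma in_vals f N a : In a (vals f N) -> exists n, (1 <= n <= N)%nat /\ a = f n.
Proof.
  intros H. apply in_map_iff in H. destruct H as (n & <- & H). apply in_seq in H.
  exists n. split; [lia|reflexivity].
Qed.

Lemma length_vals f N : length (vals f N) = N.
Proof. unfold vals. rewrite length_map, length_seq. reflexivity. Qed.

Lemma repr_A_trunc f N n : repr 1 (vals f N) n = INR (A_trunc f N n).
Proof.
  unfold A_trunc. rewrite length_filter_Rsum, Rsum_list_prod. unfold repr, vals.
  rewrite Rsum_map. apply Rsum_ext; intros a. rewrite Rsum_map.
  apply Rsum_ext; intros b. rewrite Z.mul_1_l. reflexivity.
Qed.

Lemma repr_Atilde_trunc f N n : repr (-1) (vals f N) n = INR (Atilde_trunc f N n).
Proof.
  unfold Atilde_trunc. rewrite length_filter_Rsum, Rsum_list_prod. unfold repr, vals.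
  rewrite Rsum_map. apply Rsum_ext; intros a. rewrite Rsum_map.
  apply Rsum_ext; intros b. cbn [fst snd].
  replace (f a + -1 * f b)%Z with (f a - f b)%Z by ring. reflexivity.
Qed.

Lemma repr_opp v n : repr (-1) v (- n) = repr (-1) v n.
Proof.
  unfold repr. rewrite Rsum_exchange. do 2 (apply Rsum_ext; intros).
  apply Zdelta_congr. lia.
Qed.

(** Both hypotheses take one form. That on $\tilde A_f$ concerns positive $n$ only and extends to
    negative $n$ by exchanging the two variables. *)
Lemma repr_small f :
  A_small f \/ Atilde_small f -> exists s, (s = 1%Z \/ s = (-1)%Z) /\
  forall e, 0 < e -> exists C (M : nat), 1 <= C /\ forall N n, (1 <= Z.abs n)%Z ->
    (Z.of_nat M <= Z.abs n)%Z -> repr s (vals f N) n <= C * Rpower (IZR (Z.abs n)) e.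
Proof.
  assert (HC : forall C x e, C * Rpower x e <= Rmax C 1 * Rpower x e).
  { intros C x e. apply Rmult_le_compat_r; [left; apply exp_pos|]. apply Rmax_l. }
  intros [H|H]; [exists 1%Z | exists (-1)%Z]; (split; [auto|]); intros e He;
    destruct (H e He) as (C & M & HM & HCM); exists (Rmax C 1), (Z.to_nat M);
    (split; [apply Rmax_r|]); intros N n Hn1 Hn; eapply Rle_trans; try apply HC.
  - rewrite repr_A_trunc. apply HCM. lia.
  - replace (repr (-1) (vals f N) n) with (repr (-1) (vals f N) (Z.abs n)).
    + rewrite repr_Atilde_trunc. apply HCM. lia.
    + destruct (Z.abs_eq_or_opp n) as [-> | ->]; auto using repr_opp.
Qed.

Definition poly_growth (f : nat -> Z) (t : nat) (B : R) : Prop :=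
  forall N n, (1 <= n <= N)%nat -> IZR (Z.abs (f n)) <= B * INR N ^ t.

(** The finitely many values before [n0] are absorbed into [B]. *)
Lemma poly_growth_of_eventually f :
  (exists (t n0 : nat), forall n : nat, (n0 <= n)%nat -> IZR (Z.abs (f n)) <= INR n ^ t) ->
  exists t B, 1 <= B /\ poly_growth f t B.
Proof.
  intros (t & n0 & H). exists t, (1 + Rsum (fun n => IZR (Z.abs (f n))) (seq 0 n0)).
  assert (Hpos : forall n, 0 <= IZR (Z.abs (f n))) by (intros; apply IZR_le; lia).
  assert (H0 : 0 <= Rsum (fun n => IZR (Z.abs (f n))) (seq 0 n0)) by (apply Rsum_nonneg; auto).
  split; [lra|]. intros N n Hn.
  assert (H1 : 1 <= INR N) by (apply (le_INR 1); lia).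
  assert (H2 : 1 <= INR N ^ t) by (apply pow_R1_Rle; auto).
  destruct (Nat.le_gt_cases n0 n) as [Hle|Hlt].
  - assert (IZR (Z.abs (f n)) <= INR N ^ t); [|nra].
    eapply Rle_trans; [apply H; auto|]. apply pow_incr. split; [apply pos_INR|].
    apply le_INR; lia.
  - assert (IZR (Z.abs (f n)) <= Rsum (fun n => IZR (Z.abs (f n))) (seq 0 n0)); [|nra].
    apply (Rsum_ge_term (fun n => IZR (Z.abs (f n)))); auto. apply in_seq; lia.
Qed.

Lemma Rpower_ge_1 x e : 1 <= x -> 0 <= e -> 1 <= Rpower x e.
Proof. intros Hx He. rewrite <- (Rpower_O x) by lra. apply Rle_Rpower; auto. Qed.

(** Either [f] has two values far apart, and the representation bound applies, or all its values lie
    in a fixed window around [f 1], and the clustered bound applies. *)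
Lemma energy_diffs_vals f t B :
  1 <= B -> poly_growth f t B -> A_small f \/ Atilde_small f ->
  forall e, 0 < e -> exists C N0, 0 <= C /\ forall N, (N0 <= N)%nat -> (1 <= N)%nat ->
    energy (diffs (vals f N)) <= C * Rpower (INR N) e * energy (vals f N) ^ 2.
Proof.
  intros HB Hf Hsmall e He.
  destruct (repr_small f Hsmall) as (s & Hs & Hrep).
  (* The represented integers are at most $2BN^t$ in absolute value and [X] enters squared, so
     $2te_0 \le e$ is required. *)
  set (e0 := e / (2 * INR t + 1)).
  assert (Ht := pos_INR t).
  assert (He0 : 0 < e0) by (apply Rdiv_lt_0_compat; lra).
  destruct (Hrep e0 He0) as (C & M & HC & HCM).
  (* Using [S M] for [M] also secures the condition $1 \le |n|$ of [repr_small]. *)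
  destruct (classic (exists y1 y2, (1 <= y1)%nat /\ (1 <= y2)%nat /\
     (2 * Z.of_nat (S M) <= Z.abs (f y1 - f y2))%Z)) as [(y1 & y2 & Hy1 & Hy2 & Hfar)|Hnot].
  - set (C1 := C * Rpower (2 * B) e0).
    assert (HC1 : 1 <= C1).
    { assert (1 <= Rpower (2 * B) e0) by (apply Rpower_ge_1; lra). unfold C1; nra. }
    exists (C1 ^ 2 * (1 + 2 * INR (S M))), (y1 + y2)%nat. split.
    { assert (H := pos_INR (S M)). nra. }
    intros N HN HN1.
    assert (HN' : 1 <= INR N) by (apply (le_INR 1); lia).
    set (X := C1 * Rpower (INR N) (INR t * e0)).
    assert (HX1 : 1 <= X).
    { assert (1 <= Rpower (INR N) (INR t * e0)) by (apply Rpower_ge_1; [auto|nra]).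
      unfold X; nra. }
    assert (HE := energy_diffs_le s (vals f N) (S M) X Hs ltac:(lra)).
    rewrite length_vals in HE.
    assert (HE' : energy (diffs (vals f N)) <= INR N ^ 2 * (X + 2 * INR (S M) * X ^ 2)).
    { apply HE.
      - intros a b Ha Hb Hab. apply in_vals in Ha, Hb.
        destruct Ha as (n & Hn & ->), Hb as (m & Hm & ->).
        eapply Rle_trans; [apply HCM; lia|].
        unfold X, C1. rewrite Rmult_assoc. apply Rmult_le_compat_l; [lra|].
        rewrite (Rmult_comm (INR t)), <- Rpower_mult.
        assert (HNt : 1 <= INR N ^ t) by (apply pow_R1_Rle; auto).
        replace (Rpower (Rpower (INR N) e0) (INR t)) with (Rpower (INR N ^ t) e0).
        2:{ rewrite <- Rpower_pow, !Rpower_mult by lra. f_equal. ring. }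
        rewrite Rpower_mult_distr by lra.
        apply Rle_Rpower_l; [lra|]. split; [apply IZR_lt; lia|].
        assert (H1 := Hf N n Hn). assert (H2 := Hf N m Hm).
        apply Rle_trans with (IZR (Z.abs (f n)) + IZR (Z.abs (f m))); [|lra].
        rewrite <- plus_IZR. apply IZR_le. destruct Hs; subst s; lia.
      - exists (f y1), (f y2). split; [|split; auto]; apply in_map, in_seq; lia. }
    eapply Rle_trans; [apply HE'|].
    assert (Hmu := energy_ge_length (vals f N)). rewrite length_vals in Hmu.
    assert (HX2 : X ^ 2 <= C1 ^ 2 * Rpower (INR N) e).
    { unfold X. rewrite Rpow_mult_distr. apply Rmult_le_compat_l; [apply pow2_ge_0|].
      simpl. rewrite Rmult_1_r, <- Rpower_plus. apply Rle_Rpower; auto.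
      replace e with (e0 * (2 * INR t + 1)) by (unfold e0; field; lra). nra. }
    assert (HM := pos_INR (S M)).
    apply Rle_trans with (INR N ^ 2 * (C1 ^ 2 * (1 + 2 * INR (S M)) * Rpower (INR N) e)).
    + apply Rmult_le_compat_l; [apply pow2_ge_0|].
      apply Rle_trans with (X ^ 2 * (1 + 2 * INR (S M))); [nra|].
      assert (0 <= 1 + 2 * INR (S M)) by lra. nra.
    + rewrite Rmult_comm. apply Rmult_le_compat_l.
      * apply Rmult_le_pos; [|left; apply exp_pos]. nra.
      * apply pow_incr. lra.
  - exists (INR (4 * S M) ^ 2), 0%nat. split; [apply pow2_ge_0|]. intros N _ HN.
    eapply Rle_trans.
    + apply (energy_diffs_le_clustered _ (f 1%nat - 2 * Z.of_nat (S M)) (4 * S M)).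
      intros a Ha. apply in_vals in Ha. destruct Ha as (n & Hn & ->).
      assert (~ (2 * Z.of_nat (S M) <= Z.abs (f n - f 1%nat))%Z).
      { intros H. apply Hnot. exists n, 1%nat. repeat split; auto; lia. }
      lia.
    + assert (1 <= Rpower (INR N) e) by (apply Rpower_ge_1; [apply (le_INR 1); lia|lra]).
      assert (H0 := pow2_ge_0 (INR (4 * S M))).
      apply Rmult_le_compat_r; [apply pow2_ge_0|]. nra.
Qed.

(** * Covering the exceptional set *)

Lemma Rabs_le_inv x a : Rabs x <= a -> - a <= x <= a.
Proof. unfold Rabs. destruct (Rcase_abs x); lra. Qed.

Lemma in_dilates H l a :
  In a (dilates H l) -> exists h b, In h H /\ In b l /\ a = (h * b)%Z.
Proof.
  intros Ha. apply in_flat_map in Ha. destruct Ha as (h & Hh & Ha).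
  apply in_map_iff in Ha. destruct Ha as (b & <- & Hb). exists h, b; auto.
Qed.

Lemma in_nzdiffs v a :
  In a (nzdiffs v) -> a <> 0%Z /\ exists b c, In b v /\ In c v /\ a = (b - c)%Z.
Proof.
  intros Ha. apply filter_In in Ha. destruct Ha as [Ha E]. split.
  - intros ->. discriminate.
  - apply in_map_iff in Ha. destruct Ha as ([b c] & <- & Hbc).
    apply in_prod_iff in Hbc. exists b, c. tauto.
Qed.

Lemma exists_list_bound (l : list Z) : exists W, 1 <= W /\ forall a, In a l -> IZR (Z.abs a) <= W.
Proof.
  assert (H0 : forall a, In a l -> 0 <= IZR (Z.abs a)) by (intros; apply IZR_le; lia).
  exists (1 + Rsum (fun a => IZR (Z.abs a)) l). split.
  - assert (H := Rsum_nonneg _ l H0). lra.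
  - intros a Ha. assert (H := Rsum_ge_term (fun a => IZR (Z.abs a)) l a H0 Ha). lra.
Qed.

(* Chebyshev's inequality on the grid [j / Q - K]; a grid point controls its cell because
   [Q] is large compared with the derivative of the cosine sum. *)
Lemma small_values_cover (T : list Z) (K : nat) (c : R) :
  0 < c -> exists l : list (R * R),
    (forall p, In p l -> fst p <= snd p) /\
    (forall x, - INR K <= x < INR K -> cosum T x < - (2 * c) ->
       exists p, In p l /\ fst p < x < snd p) /\
    Rsum (fun p => snd p - fst p) l <= 4 * INR K * energy T / c ^ 2.
Proof.
  intros Hc. destruct (exists_list_bound T) as (W & HW1 & HW).
  assert (Hpi := PI_RGT_0). assert (HlT := pos_INR (length T)).
  set (Y := INR (length T) * (2 * PI * W)).
  assert (HY : 0 <= Y) by (unfold Y; apply Rmult_le_pos; [lra|nra]).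
  assert (HYc : 0 <= Y / c) by (apply Rmult_le_pos; [|left; apply Rinv_0_lt_compat]; lra).
  (* $Q > Y/c$ keeps the variation of [cosum T] within a cell at most [c]; $Q > 2W$ puts all
     differences of frequencies below [Q], as exact orthogonality needs. *)
  destruct (INR_unbounded (Y / c + 2 * W)) as [Q HQ].
  assert (HQ0 : 0 < INR Q) by lra.
  assert (HQi : 0 < / INR Q) by (apply Rinv_0_lt_compat; lra).
  set (x := fun j => INR j / INR Q - IZR (Z.of_nat K)).
  set (bad := fun j => if Rlt_dec (cosum T (x j)) (- c) then true else false).
  set (bl := filter bad (seq 0 (2 * K * Q))).
  (* The intervals extend to the left as well because covers are open and a point may coincide with
     its grid point. *)
  exists (map (fun j => (x j - / INR Q, x j + / INR Q)) bl). split; [|split].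
  - intros p Hp. apply in_map_iff in Hp. destruct Hp as (j & <- & _). simpl. lra.
  - intros a Ha Hlow. set (z := (a + INR K) * INR Q).
    assert (Hz0 : 0 <= z) by (unfold z; apply Rmult_le_pos; lra).
    destruct (base_Int_part z) as [Hz1 Hz2].
    assert (Hi : (0 <= Int_part z)%Z).
    { apply Z.lt_succ_r. apply lt_IZR. unfold Z.succ. rewrite plus_IZR. lra. }
    set (j := Z.to_nat (Int_part z)).
    assert (Hj : INR j = IZR (Int_part z)) by (unfold j; rewrite INR_IZR_INZ, Z2Nat.id; auto).
    assert (Hza : a = z / INR Q - INR K) by (unfold z; field; lra).
    assert (Hxj : x j <= a < x j + / INR Q).
    { unfold x. rewrite <- INR_IZR_INZ. rewrite Hza at 1 2. unfold Rdiv. split; nra. }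
    exists (x j - / INR Q, x j + / INR Q). split; [|simpl; lra].
    apply in_map_iff. exists j. split; auto. apply filter_In. split.
    + apply in_seq. split; [lia|]. apply INR_lt. rewrite Nat.add_0_l, !mult_INR, Hj.
      simpl (INR 2). eapply Rle_lt_trans; [apply Hz1|]. unfold z.
      apply Rmult_lt_compat_r; lra.
    + unfold bad. destruct (Rlt_dec (cosum T (x j)) (- c)) as [_|Hn]; auto.
      exfalso. assert (HL := cosum_lipschitz T W a (x j) HW).
      assert (Hd : Rabs (a - x j) <= / INR Q) by (apply Rabs_le; lra).
      assert (HLc : INR (length T) * (2 * PI * W * Rabs (a - x j)) <= c).
      { apply Rle_trans with (Y * / INR Q).
        - rewrite <- (Rmult_assoc (INR (length T))). apply Rmult_le_compat_l; auto.
        - apply Rmult_le_reg_r with (INR Q); auto.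
          rewrite Rmult_assoc, Rinv_l by lra.
          assert (Y = Y / c * c) by (field; lra). nra. }
      assert (HL' := Rle_trans _ _ _ HL HLc). apply Rabs_le_inv in HL'. lra.
  - rewrite Rsum_map. cbn [fst snd].
    rewrite (Rsum_ext _ (fun _ => 2 * / INR Q)) by (intros; ring). rewrite Rsum_const.
    assert (HTQ : forall a b, In a T -> In b T -> (Z.abs (a - b) < Z.of_nat Q)%Z).
    { intros a b Ha Hb. apply HW in Ha, Hb. apply lt_IZR. rewrite <- INR_IZR_INZ.
      apply Rle_lt_trans with (IZR (Z.abs a) + IZR (Z.abs b)); [|lra].
      rewrite <- plus_IZR. apply IZR_le. lia. }
    assert (HM := cosum_grid_mean_square T Q (2 * K) (Z.of_nat K) HTQ).
    fold (x) in HM.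
    assert (HB : INR (length bl) * c ^ 2 <= INR (2 * K * Q) * energy T).
    { eapply Rle_trans; [|apply HM]. unfold bl.
      rewrite length_filter_Rsum, Rmult_comm, <- Rsum_scal.
      apply Rsum_le_in. intros j _. fold (x j). unfold bad.
      destruct (Rlt_dec (cosum T (x j)) (- c)) as [Hlt|_]; [nra|].
      assert (H := pow2_ge_0 (cosum T (x j))). lra. }
    rewrite !mult_INR in HB. simpl (INR 2) in HB.
    assert (Hc2 : 0 < c ^ 2) by nra.
    apply Rmult_le_reg_r with (c ^ 2 * INR Q); [nra|].
    replace (4 * INR K * energy T / c ^ 2 * (c ^ 2 * INR Q))
      with (2 * ((1 + 1) * INR K * INR Q * energy T)) by (field; lra).
    replace (INR (length bl) * (2 * / INR Q) * (c ^ 2 * INR Q))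
      with (2 * (INR (length bl) * c ^ 2)) by (field; lra). lra.
Qed.

(** * Low discrepancy forces very negative cosine sums *)

Lemma xseq_range f alpha n : 0 <= xseq f alpha n < 1.
Proof. unfold xseq. destruct (base_fp (IZR (f n) * alpha)). lra. Qed.

Lemma cos_xseq f alpha h n th :
  cos (2 * PI * IZR h * xseq f alpha n + th) = cos (2 * PI * IZR (f n) * (IZR h * alpha) + th).
Proof.
  unfold xseq, frac_part.
  rewrite <- (cos_period_Z _ (h * Int_part (IZR (f n) * alpha))). f_equal.
  rewrite mult_IZR. ring.
Qed.

(** Koksma's inequality with phases $0$ and $-\pi/2$ bounds the cosine and the sine sum
    separately. *)
Lemma cosum_diffs_le_discrepancy f alpha N d h :
  (1 <= N)%nat -> is_discrepancy (xseq f alpha) N d -> (0 < h)%Z ->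
  cosum (diffs (vals f N)) (IZR h * alpha) <= 2 * (2 * PI * IZR h * (INR N * d)) ^ 2.
Proof.
  intros HN Hd Hh. rewrite cosum_diffs. unfold vals. rewrite !Rsum_map.
  set (Y := 2 * PI * IZR h * (INR N * d)).
  assert (H1 := koksma_cos _ N d h 0 HN (xseq_range f alpha) Hd Hh).
  assert (H2 := koksma_cos _ N d h (- (PI / 2)) HN (xseq_range f alpha) Hd Hh).
  rewrite (Rsum_ext _ (fun n => cos (2 * PI * IZR (f n) * (IZR h * alpha)))) in H1.
  2:{ intros n. rewrite cos_xseq. f_equal. ring. }
  rewrite (Rsum_ext _ (fun n => sin (2 * PI * IZR (f n) * (IZR h * alpha)))) in H2.
  2:{ intros n. rewrite cos_xseq, <- cos_shift, <- cos_neg. f_equal. ring. }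
  fold Y in H1, H2. apply pow_maj_Rabs with (n := 2%nat) in H1, H2. lra.
Qed.

Lemma is_discrepancy_nonneg x N d : is_discrepancy x N d -> 0 <= d.
Proof.
  intros [Hub _]. eapply Rle_trans; [apply Rabs_pos|]. apply Hub.
  exists 0, 1. repeat split; lra.
Qed.

Definition dilation_set (D r : nat) : list Z :=
  Zrange (Z.of_nat D ^ (2 * Z.of_nat r) + 1) D.

Definition low_discrepancy f (e : R) (N : nat) (alpha : R) : Prop :=
  exists d, is_discrepancy (xseq f alpha) N d /\ INR N * d < Rpower (INR N) (1 / 2 - e).

Lemma in_dilation_set D r h :
  (1 <= D)%nat -> In h (dilation_set D r) ->
  (0 < h)%Z /\ (Z.of_nat D ^ (2 * Z.of_nat r) < h <= Z.of_nat D ^ (2 * Z.of_nat r) + Z.of_nat D)%Z.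
Proof.
  intros HD Hh. apply in_Zrange in Hh.
  assert (0 <= Z.of_nat D ^ (2 * Z.of_nat r))%Z by (apply Z.pow_nonneg; lia). lia.
Qed.

Lemma IZR_pow_nat D k : IZR (Z.of_nat D ^ Z.of_nat k) = INR D ^ k.
Proof. rewrite <- pow_IZR, <- INR_IZR_INZ. reflexivity. Qed.

Lemma dilation_set_le D r h :
  (1 <= D)%nat -> (1 <= r)%nat -> In h (dilation_set D r) -> IZR h <= 2 * INR D ^ (2 * r).
Proof.
  intros HD Hr Hh. destruct (in_dilation_set D r h HD Hh) as [_ [_ H]].
  apply IZR_le in H. replace (2 * Z.of_nat r)%Z with (Z.of_nat (2 * r)) in H by lia.
  rewrite plus_IZR, IZR_pow_nat, <- INR_IZR_INZ in H.
  assert (H1 : 1 <= INR D) by (apply (le_INR 1); lia).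
  assert (H2 : INR D ^ 1 <= INR D ^ (2 * r)) by (apply Rle_pow; [auto|lia]).
  rewrite pow_1 in H2. lra.
Qed.

(** Each dilated difference is nonzero and at most $2D^{2r} \cdot 2BD^{qt}$ in absolute value. By
    $4B < D$ this is below $D^{2r+qt+1} \le D^{r^2}$, so [few_divisors] applies. *)
Lemma energy_dilation_set f t B D r q :
  1 <= B -> poly_growth f t B -> 4 * B < INR D -> (1 <= r)%nat ->
  (2 * r + q * t + 1 <= r * r)%nat ->
  energy (dilates (dilation_set D r) (nzdiffs (vals f (D ^ q))))
    <= INR r * INR D * energy (diffs (vals f (D ^ q))).
Proof.
  intros HB Hf HD Hr Hrq.
  assert (HD1 : (1 <= D)%nat) by (apply INR_le; simpl; lra).
  assert (HDR : 1 <= INR D) by lra.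
  eapply Rle_trans.
  - apply (energy_dilates _ _ r).
    + intros h Hh. apply in_dilation_set in Hh; lia.
    + intros n Hn. apply in_dilates in Hn. destruct Hn as (h & b & Hh & Hb & ->).
      assert (Hh1 := in_dilation_set _ _ _ HD1 Hh).
      apply in_nzdiffs in Hb. destruct Hb as (Hb0 & b1 & b2 & Hb1 & Hb2 & ->).
      apply (few_divisors (Z.of_nat D)); [lia|apply NoDup_Zrange| |nia|].
      * intros a Ha. apply in_dilation_set; auto.
      * apply lt_IZR. rewrite <- Nat2Z.inj_mul, IZR_pow_nat, Z.abs_mul, mult_IZR.
        rewrite (Z.abs_eq h) by lia.
        assert (HhR := dilation_set_le D r h HD1 Hr Hh).
        apply in_vals in Hb1, Hb2. destruct Hb1 as (n1 & Hn1 & ->), Hb2 as (n2 & Hn2 & ->).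
        assert (H1 := Hf _ _ Hn1). assert (H2 := Hf _ _ Hn2).
        rewrite pow_INR, <- pow_mult in H1, H2.
        assert (H3 : IZR (Z.abs (f n1 - f n2)) <= 2 * B * INR D ^ (q * t)).
        { apply Rle_trans with (IZR (Z.abs (f n1)) + IZR (Z.abs (f n2))); [|lra].
          rewrite <- plus_IZR. apply IZR_le. lia. }
        apply Rle_lt_trans with ((2 * INR D ^ (2 * r)) * (2 * B * INR D ^ (q * t))).
        { apply Rmult_le_compat; auto; apply IZR_le; lia. }
        apply Rlt_le_trans with (INR D ^ (2 * r + q * t + 1)).
        2:{ apply Rle_pow; auto. }
        rewrite !pow_add, pow_1.
        assert (0 < INR D ^ (2 * r)) by (apply pow_lt; lra).
        assert (0 < INR D ^ (q * t)) by (apply pow_lt; lra).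
        assert (0 < INR D ^ (2 * r) * INR D ^ (q * t)) by (apply Rmult_lt_0_compat; auto).
        replace (2 * INR D ^ (2 * r) * (2 * B * INR D ^ (q * t))) with
          (INR D ^ (2 * r) * INR D ^ (q * t) * (4 * B)) by ring.
        apply Rmult_lt_compat_l; auto.
  - unfold dilation_set. rewrite length_Zrange. apply Rmult_le_compat_l.
    + apply Rmult_le_pos; apply pos_INR.
    + apply energy_filter_le.
Qed.

(** Low discrepancy makes every $|S_N(h\alpha)|^2$ at most $N/8$. Subtracting the mean $\mu \ge N$
    for each of the $D$ dilations leaves at most $-\frac{7}{8} D\mu$. *)
Lemma low_discrepancy_cosum f (E D r q : nat) alpha :
  (1 <= E)%nat -> (64 <= D)%nat -> (1 <= r)%nat -> q = (E * (2 * r + 1))%nat ->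
  low_discrepancy f (1 / INR E) (D ^ q) alpha ->
  cosum (dilates (dilation_set D r) (nzdiffs (vals f (D ^ q)))) alpha
    < - (2 * (INR D * energy (vals f (D ^ q)) / 4)).
Proof.
  intros HE HD Hr Hq (d & Hd & Hlow). set (N := (D ^ q)%nat) in *.
  assert (HDR : 64 <= INR D) by (apply le_INR in HD; simpl in HD; lra).
  assert (HN : INR N = INR D ^ q) by (unfold N; apply pow_INR).
  assert (HN0 : 1 <= INR N) by (rewrite HN; apply pow_R1_Rle; lra).
  assert (HN1 : (1 <= N)%nat) by (apply INR_le; simpl; lra).

  assert (Hpi := PI_RGT_0). assert (Hpi4 := PI_4).
  assert (Hd0 := is_discrepancy_nonneg _ _ _ Hd).
  assert (HNd : 0 <= INR N * d) by (apply Rmult_le_pos; lra).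
  set (s := Rpower (INR N) (1 / 2)) in *.
  assert (Hs0 : 0 < s) by apply exp_pos.
  assert (Hs : s * s = INR N).
  { unfold s. rewrite <- Rpower_plus. replace (1 / 2 + 1 / 2) with 1 by field.
    apply Rpower_1; lra. }
  assert (HER : 1 <= INR E) by (apply (le_INR 1); lia).
  (* The exponent [q] is chosen so that $N^{1/E} = D^{2r+1}$, which beats the size of $h$ by a
     factor of order $D$. *)
  assert (HNE : Rpower (INR N) (1 / INR E) = INR D ^ (2 * r + 1)).
  { rewrite HN, <- !Rpower_pow, Rpower_mult by lra. f_equal.
    rewrite Hq, mult_INR. field. lra. }
  set (Z0 := INR D ^ (2 * r)). assert (HZ0 : 0 < Z0) by (apply pow_lt; lra).
  assert (Hsmall : 64 * Z0 * (INR N * d) < s).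
  { replace s with (Rpower (INR N) (1 / 2 - 1 / INR E) * Rpower (INR N) (1 / INR E)).
    2:{ rewrite <- Rpower_plus. unfold s. f_equal. ring. }
    rewrite HNE, pow_add, pow_1. fold Z0.
    apply Rle_lt_trans with (INR N * d * (Z0 * INR D)).
    - assert (0 <= Z0 * (INR N * d)) by (apply Rmult_le_pos; lra). nra.
    - apply Rmult_lt_compat_r; auto. apply Rmult_lt_0_compat; lra. }
  assert (Hall : Rsum (fun h => cosum (diffs (vals f N)) (IZR h * alpha)) (dilation_set D r)
                 <= INR D * (INR N / 8)).
  { replace (INR D) with (INR (length (dilation_set D r)))
      by (unfold dilation_set; rewrite length_Zrange; reflexivity).
    apply Rsum_le_const. intros h Hh.
    destruct (in_dilation_set D r h ltac:(lia) Hh) as [Hh0 _].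
    assert (Hh1 := dilation_set_le D r h ltac:(lia) Hr Hh). fold Z0 in Hh1.
    eapply Rle_trans; [apply (cosum_diffs_le_discrepancy f alpha N d); auto|].
    apply IZR_lt in Hh0.
    assert (HY0 : 0 <= 2 * PI * IZR h) by nra.
    (* Here $\pi \le 4$ and $h \le 2D^{2r}$. With [Hsmall] this gives $Y \le s/4$, hence $2Y^2 \le
       N/8$. *)
    assert (HY1 : 2 * PI * IZR h <= 16 * Z0) by nra.
    assert (HY2 : 2 * PI * IZR h * (INR N * d) <= 16 * Z0 * (INR N * d))
      by (apply Rmult_le_compat_r; auto).
    assert (HY3 : 0 <= 2 * PI * IZR h * (INR N * d)) by (apply Rmult_le_pos; auto).
    set (Y := 2 * PI * IZR h * (INR N * d)) in *.
    assert (Y <= s / 4) by lra. rewrite <- Hs. nra. }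
  rewrite (Rsum_ext _ (fun h => energy (vals f N) + cosum (nzdiffs (vals f N)) (IZR h * alpha)))
    in Hall by (intros; apply cosum_diffs_split).
  rewrite Rsum_plus, Rsum_const, <- cosum_dilates in Hall.
  unfold dilation_set at 1 in Hall. rewrite length_Zrange in Hall.
  assert (Hmu := energy_ge_length (vals f N)). rewrite length_vals in Hmu.
  assert (INR D * INR N <= INR D * energy (vals f N)) by (apply Rmult_le_compat_l; lra).
  assert (0 < INR D * INR N) by nra. lra.
Qed.

(** One parameter [E] bounds $\alpha$, fixes $\varepsilon = 1/E$ and marks where low discrepancy
    begins, so countably many such sets exhaust the exceptional set. *)
Lemma low_discrepancy_small_covers f (E : nat) :
  (exists (t n0 : nat), forall n : nat, (n0 <= n)%nat -> IZR (Z.abs (f n)) <= INR n ^ t) ->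
  A_small f \/ Atilde_small f -> (1 <= E)%nat ->
  has_small_covers (fun alpha => - INR E <= alpha < INR E /\
    forall N, (E <= N)%nat -> (1 <= N)%nat -> low_discrepancy f (1 / INR E) N alpha).
Proof.
  intros Hgrowth Hsmall HE eta Heta.
  destruct (poly_growth_of_eventually f Hgrowth) as (t & B & HB & Hf).
  (* Since $qt$ grows like $2Etr$, taking $r > 3Et$ lets $r^2$ dominate it. *)
  set (r := (3 * E * t + 4)%nat). set (q := (E * (2 * r + 1))%nat).
  assert (Hrq : (2 * r + q * t + 1 <= r * r)%nat) by (unfold q, r; nia).
  assert (Hq1 : (1 <= q)%nat) by (unfold q, r; nia).
  assert (HqR : 1 <= INR q) by (apply (le_INR 1); lia).
  (* With this exponent the loss $N^{1/(2q)}$ is only $\sqrt D$, half of the saving $D$ from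
     averaging over the dilations. *)
  destruct (energy_diffs_vals f t B HB Hf Hsmall (1 / (2 * INR q))) as (C & N0 & HC & HCN).
  { apply Rdiv_lt_0_compat; lra. }
  (* The total length of the cover comes out as at most $G / \sqrt D$; the factor 64 is 4 from the
     cover times 16 from the threshold $D\mu/4$. *)
  set (G := 64 * INR E * INR r * C).
  assert (HG : 0 <= G).
  { unfold G. repeat apply Rmult_le_pos; auto using pos_INR; lra. }
  assert (HGe : 0 <= (G / eta) ^ 2) by apply pow2_ge_0.
  destruct (INR_unbounded (64 + 4 * B + INR N0 + INR E + (G / eta) ^ 2)) as [D HDbig].
  assert (HN0 := pos_INR N0). assert (HER : 1 <= INR E) by (apply (le_INR 1); lia).
  assert (HD64 : (64 <= D)%nat) by (apply INR_le; simpl; lra).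
  set (N := (D ^ q)%nat).
  assert (HDN : (D <= N)%nat).
  { unfold N. rewrite <- (Nat.pow_1_r D) at 1. apply Nat.pow_le_mono_r; lia. }
  assert (HDN0 : (N0 <= D)%nat) by (apply INR_le; lra).
  assert (HDE : (E <= D)%nat) by (apply INR_le; lra).
  assert (Hmu := energy_ge_length (vals f N)). rewrite length_vals in Hmu.
  assert (HNR : 1 <= INR N) by (apply (le_INR 1); lia).
  set (mu := energy (vals f N)) in *.
  set (T := dilates (dilation_set D r) (nzdiffs (vals f N))).
  assert (Hc : 0 < INR D * mu / 4) by nra.
  destruct (small_values_cover T E (INR D * mu / 4) Hc) as (l & Hl1 & Hl2 & Hl3).
  exists l. split; [auto|]. split.
  - intros x [Hx Hlow]. apply Hl2; auto.
    apply (low_discrepancy_cosum f E D r q); auto; [unfold r; lia|].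
    apply Hlow; fold N; lia.
  - eapply Rle_trans; [apply Hl3|].
    assert (HT : energy T <= INR r * INR D * energy (diffs (vals f N))).
    { apply (energy_dilation_set f t B D r q); auto; [lra|unfold r; lia]. }
    assert (HEn := HCN N ltac:(lia) ltac:(lia)). fold mu in HEn.
    replace (Rpower (INR N) (1 / (2 * INR q))) with (sqrt (INR D)) in HEn.
    2:{ unfold N. rewrite pow_INR, <- Rpower_pow, Rpower_mult by lra.
        replace (INR q * (1 / (2 * INR q))) with (/ 2) by (field; lra).
        symmetry; apply Rpower_sqrt; lra. }
    set (sD := sqrt (INR D)) in *.
    assert (HsD0 : 0 < sD) by (apply sqrt_lt_R0; lra).
    assert (HsD : sD * sD = INR D) by (apply sqrt_sqrt; lra).
    assert (HsG : G <= eta * sD).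
    { assert (HGs : G / eta <= sD).
      { apply Rsqr_incr_0_var; [|lra]. unfold Rsqr. rewrite HsD. simpl in HDbig. lra. }
      replace G with (eta * (G / eta)) by (field; lra). apply Rmult_le_compat_l; lra. }
    assert (HTb : energy T <= INR r * INR D * (C * sD * mu ^ 2)).
    { eapply Rle_trans; [apply HT|]. apply Rmult_le_compat_l; auto.
      apply Rmult_le_pos; apply pos_INR. }
    assert (Hc2 : 0 < (INR D * mu / 4) ^ 2) by (apply pow_lt; auto).
    apply Rmult_le_reg_r with ((INR D * mu / 4) ^ 2); auto.
    unfold Rdiv at 1. rewrite Rmult_assoc, Rinv_l, Rmult_1_r by lra.
    apply Rle_trans with (4 * INR E * (INR r * INR D * (C * sD * mu ^ 2))).
    { apply Rmult_le_compat_l; lra. }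
    replace (4 * INR E * (INR r * INR D * (C * sD * mu ^ 2))) with
      (G * (sD * (INR D * mu ^ 2) / 16)) by (unfold G; field).
    replace (eta * (INR D * mu / 4) ^ 2) with (eta * sD * (sD * (INR D * mu ^ 2) / 16)).
    2:{ replace ((INR D * mu / 4) ^ 2) with (INR D * (INR D * mu ^ 2) / 16) by field.
        rewrite <- HsD at 2. field. }
    apply Rmult_le_compat_r; auto.
    assert (0 < mu ^ 2) by (apply pow_lt; lra).
    assert (0 < INR D * mu ^ 2) by (apply Rmult_lt_0_compat; lra). nra.
Qed.

Theorem theorem2 (f : nat -> Z)
  (hgrowth : exists (t n0 : nat), forall n : nat, (n0 <= n)%nat ->
               IZR (Z.abs (f n)) <= INR n ^ t)
  (hA : A_small f \/ Atilde_small f) :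
  null_set (fun alpha => ~ (forall eps, 0 < eps ->
     forall M : nat, exists N : nat, (M <= N)%nat /\ (1 <= N)%nat /\
       forall d, is_discrepancy (xseq f alpha) N d ->
         INR N * d >= Rpower (INR N) (1/2 - eps))).
Proof.
  apply null_set_of_small_covers with (1 := fun n =>
    low_discrepancy_small_covers f (S n) hgrowth hA ltac:(lia)).
  intros alpha Hbad. apply not_all_ex_not in Hbad. destruct Hbad as [eps Hbad].
  apply imply_to_and in Hbad. destruct Hbad as [Heps Hbad].
  apply not_all_ex_not in Hbad. destruct Hbad as [M Hbad].
  (* A single [n] exceeds $|\alpha|$, [M] and $1/\varepsilon$, so $\alpha$ belongs to the set with
     parameter [S n]. *)
  destruct (INR_unbounded (Rabs alpha + INR M + / eps)) as [n Hn].
  assert (Hi : 0 < / eps) by (apply Rinv_0_lt_compat; auto).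
  assert (H1 := Rabs_pos alpha). assert (H2 := pos_INR M).
  assert (HM : (M <= n)%nat) by (apply INR_le; lra).
  exists n. rewrite S_INR. split.
  - assert (Ha : Rabs alpha <= INR n) by lra. apply Rabs_le_inv in Ha. lra.
  - intros N HN HN1. apply NNPP. intros Hno. apply Hbad. exists N.
    split; [lia|]. split; [auto|]. intros d Hd. apply Rnot_lt_ge. intros Hlt.
    apply Hno. exists d. split; auto. eapply Rlt_le_trans; [apply Hlt|].
    apply Rle_Rpower; [apply (le_INR 1); lia|].
    assert (1 / (INR n + 1) <= eps); [|lra].
    rewrite <- (Rinv_inv eps). unfold Rdiv. rewrite Rmult_1_l.
    apply Rinv_le_contravar; lra.
Qed.
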